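(* Let $\Omega(\mathbb{R}^m)$ be the space of Borel probability measures on $\mathbb{R}^m$ with the metric $d_L$. The sets $\Omega_0(\mathbb{R}^m)=\{\mu\in\Omega(\mathbb{R}^m):\lim_{r\to0^+}D_r(\mu)=D_0(\mu)=\dim_H(\mu)\}$ and $\Omega_{0>}(\mathbb{R}^m)=\{\mu\in\Omega(\mathbb{R}^m):\lim_{r\to0^+}D_r(\mu)=D_0(\mu)>\dim_H(\mu)\}$ are both dense in $(\Omega(\mathbb{R}^m),d_L)$.
   Context: $d_L(\mu,\nu)=\sup\{|\int h\,d\mu-\int h\,d\nu|: h:\mathbb{R}^m\to\mathbb{R}\text{ Lipschitz with constant}\le1\}$. For $r>0$, $V_{n,r}(\mu)=\inf\{\int d(x,A)^r\,d\mu(x):\mathrm{Card}(A)\le n\}$ and $D_r(\mu)=\lim_n\frac{r\log n}{-\log V_{n,r}(\mu)}$; $e_n(\mu)=\exp\inf\{\int\log d(x,A)\,d\mu(x):\mathrm{Card}(A)\le n\}$ and $D_0(\mu)=\lim_n\frac{\log n}{-\log e_n(\mu)}$; throughout it is assumed these quantization dimensions exist whenever they occur. $\dim_H(\mu)=\inf\{\dim_H E: E\text{ Borel},\ \mu(E)=1\}$ is the Hausdorff dimension of $\mu$.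
   Formalization: Ω(R^m) is restricted to Borel probability measures with finite first moment, since otherwise d_L is infinite or undefined (∞−∞ for h(x)=|x|), and m ≥ 1 is assumed, since for m = 0 the set Ω_{0>} is empty. *)

(* Defs.v *)
From HB Require Import structures.
From mathcomp Require Import all_boot all_order all_algebra.
From mathcomp Require Import all_classical all_reals all_analysis.
Set Implicit Arguments. Unset Strict Implicit. Unset Printing Implicit Defensive.
Import Order.TTheory GRing.Theory Num.Theory.
Import numFieldNormedType.Exports.
Local Open Scope classical_set_scope.
Local Open Scope ring_scope.

Definition Rm (R : realType) (m : nat) := g_sigma_algebraType (@open 'rV[R]_m).

Definition edist {R : realType} {m : nat} (x y : 'rV[R]_m) : R :=
  Num.sqrt (\sum_(i < m) (x ord0 i - y ord0 i) ^+ 2).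

Definition lip1 {R : realType} {m : nat} (h : 'rV[R]_m -> R) : Prop :=
  forall x y, `|h x - h y| <= edist x y.

(* Omega(R^m): Borel probability measures with finite first moment
   (the domain on which d_L is a (finite) metric). *)
Definition in_Omega {R : realType} {m : nat} (mu : probability (Rm R m) R) : Prop :=
  (\int[mu]_x (edist x 0)%:E < +oo)%E.

Definition dL {R : realType} {m : nat} (mu nu : probability (Rm R m) R) : \bar R :=
  ereal_sup [set `| (\int[mu]_x (h x)%:E - \int[nu]_x (h x)%:E)%E |%E
            | h in [set h : 'rV[R]_m -> R | lip1 h]].

(* d(x,A) for a nonempty finite set A given by a sequence *)
Definition dA {R : realType} {m : nat} (x : 'rV[R]_m) (A : seq 'rV[R]_m) : R :=
  \big[Num.min/edist x (head x A)]_(a <- A) edist x a.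

Definition elog {R : realType} (x : \bar R) : \bar R :=
  match x with
  | r%:E => if r == (0:R)%R then -oo else (ln r)%:E
  | +oo => +oo
  | -oo => -oo
  end%E.

Definition codebooks {R : realType} {m : nat} (n : nat) : set (seq 'rV[R]_m) :=
  [set A | (0 < size A <= n)%N].

Definition Vq {R : realType} {m : nat} (mu : probability (Rm R m) R) (n : nat) (r : R)
  : \bar R :=
  ereal_inf [set (\int[mu]_x ((dA x A) `^ r)%:E)%E | A in codebooks n].

Definition qratio {R : realType} {m : nat} (mu : probability (Rm R m) R) (r : R) (n : nat)
  : \bar R :=
  ((r * ln n%:R)%:E * (- elog (Vq mu n r))^-1)%E.

Definition has_Dr {R : realType} {m : nat} (mu : probability (Rm R m) R) (r D : R) : Prop :=
  qratio mu r n @[n --> \oo] --> D%:E.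

Definition logen {R : realType} {m : nat} (mu : probability (Rm R m) R) (n : nat) : \bar R :=
  ereal_inf [set (\int[mu]_x elog (dA x A)%:E)%E | A in codebooks n].

Definition qratio0 {R : realType} {m : nat} (mu : probability (Rm R m) R) (n : nat) : \bar R :=
  ((ln n%:R)%:E * (- logen mu n)^-1)%E.

Definition has_D0 {R : realType} {m : nat} (mu : probability (Rm R m) R) (D : R) : Prop :=
  qratio0 mu n @[n --> \oo] --> D%:E.

Definition rdiam {R : realType} {m : nat} (U : set 'rV[R]_m) : R :=
  sup [set edist p.1 p.2 | p in U `*` U].

Definition hterm {R : realType} {m : nat} (s : R) (U : set 'rV[R]_m) : R :=
  if `[< U = set0 >] then 0 else rdiam U `^ s.

Definition hcover {R : realType} {m : nat} (delta : R) (E : set 'rV[R]_m)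
  (U : nat -> set 'rV[R]_m) : Prop :=
  E `<=` \bigcup_i U i /\ forall i x y, U i x -> U i y -> edist x y <= delta.

Definition Hdelta {R : realType} {m : nat} (s delta : R) (E : set 'rV[R]_m) : \bar R :=
  ereal_inf [set (\sum_(0 <= i <oo) (hterm s (U i))%:E)%E | U in hcover delta E].

Definition Hmeas {R : realType} {m : nat} (s : R) (E : set 'rV[R]_m) : \bar R :=
  ereal_sup [set Hdelta s delta E | delta in [set d : R | 0 < d]].

Definition dimH_set {R : realType} {m : nat} (E : set 'rV[R]_m) : \bar R :=
  ereal_inf [set s%:E | s in [set s : R | 0 <= s /\ Hmeas s E = 0%E]].

Definition dimH {R : realType} {m : nat} (mu : probability (Rm R m) R) : \bar R :=
  ereal_inf [set dimH_set E | E in [set E : set (Rm R m) | measurable E /\ mu E = 1%E]].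

Definition Dr_lim {R : realType} {m : nat} (mu : probability (Rm R m) R) (d : R) : Prop :=
  exists eps : R, 0 < eps /\ exists Dr : R -> R,
    (forall r, 0 < r < eps -> has_Dr mu r (Dr r)) /\ Dr r @[r --> 0^'+] --> d.

Definition Omega0 {R : realType} {m : nat} (mu : probability (Rm R m) R) : Prop :=
  in_Omega mu /\ exists d : R, Dr_lim mu d /\ has_D0 mu d /\ dimH mu = d%:E.

Definition Omega0gt {R : realType} {m : nat} (mu : probability (Rm R m) R) : Prop :=
  in_Omega mu /\ exists d : R, Dr_lim mu d /\ has_D0 mu d /\ (dimH mu < d%:E)%E.

(* Main.v *)
(** Rounding coordinates gives a finite-valued map [S] with [S x] close to [x] in mean.  Both sets
are reached by adding [delta * f t] to one coordinate of [S x], where [t] is uniform on [[0, 1]] and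
independent of [x].

The law of the perturbed variable [y] has [D_0 = D_r = 1] for every [r] as soon as the law of [f t]
is spread: the masses [p_u] it gives to [n] intervals of length about [2^(-u)] satisfy
[sum_u p_u <= (1 + o(1)) log_2 n].  Indeed, integrating over the scales gives
[- int log d(y, A) <= (1 + o(1)) log n] for every codebook [A] of size [n], Jensen's inequality
turns this into a lower bound on [int d(y, A)^r], and conversely [y] stays within [O(1/n)] of some
[n] points.

For [f = id] the mass distribution principle gives Hausdorff dimension 1.  For the second set, [f]
erases the binary digits of [t] of rank in a window [(N_j, 4 N_j]] whenever [t] lies in the [j]-th
dyadic interval [F_j], the dyadic intervals being enumerated generation after generation.
- Every [t] lies in one [F_j] of each generation, so the range of [f] is covered by the intervals of
  length about [2^(-4 N_j)] around the points of the grid [2^(-N_j) Z], [j] in that generation: this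
  bounds the Hausdorff dimension by 1/2.
- The measure of [F_j] tends to 0 and [N_j] grows faster than geometrically.  Up to the choice of
  the erased digits, which take [2^(o(N_J))] values, [f] is a translation at scales above
  [2^(-N_J)], and even above [2^(-N_(J+1))] outside [F_J]: taking [N_J < 8 log_2 n <= N_(J+1)] shows
  that [f] is spread. *)

From HB Require Import structures.
From mathcomp Require Import all_boot all_order all_algebra.
From mathcomp Require Import all_classical all_reals all_analysis.
From mathcomp Require Import measurable_realfun.
From mathcomp Require Import ring lra zify.
Require Import Defs.
Set Implicit Arguments. Unset Strict Implicit. Unset Printing Implicit Defensive.
Import Order.TTheory GRing.Theory Num.Theory.
Import numFieldNormedType.Exports.
Local Open Scope classical_set_scope.
Local Open Scope ring_scope.

(** * Dyadic scales *)

Section DyadicScales.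
Context {R : realType}.
Implicit Types (t x : R) (j k n u : nat).

Definition dy k : R := 2^-1 ^+ k.

Lemma dy_gt0 k : 0 < dy k. Proof. by rewrite exprn_gt0// invr_gt0. Qed.

Lemma dy_ge0 k : 0 <= dy k. Proof. exact/ltW/dy_gt0. Qed.

Lemma dyV k : dy k = (2 ^+ k)^-1. Proof. by rewrite /dy exprVn. Qed.

Lemma dyD k n : dy (k + n) = dy k * dy n. Proof. by rewrite /dy exprD. Qed.

Lemma dyS k : dy k = 2 * dy k.+1.
Proof. by rewrite /dy exprS mulrA mulfV ?mul1r. Qed.

Lemma le_dy k n : (k <= n)%N -> dy n <= dy k.
Proof. by move=> kn; rewrite /dy ler_wiXn2l// ?invr_ge0// invf_le1// ler1n. Qed.

Lemma dy_le1 k : dy k <= 1. Proof. by have := @le_dy 0 k; rewrite /dy expr0; apply. Qed.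

Lemma exp2_dy k : 2 ^+ k * dy k = 1.
Proof. by rewrite dyV mulfV// expf_neq0. Qed.

Lemma exp2_dyB k n : (k <= n)%N -> 2 ^+ k * dy n = dy (n - k).
Proof. by move=> kn; rewrite -{1}(subnKC kn) dyD mulrA exp2_dy mul1r. Qed.

(* Subtraction being truncated, [dy (n - k)] is the minimum of 1 and [2 ^ (k - n)]. *)
Lemma le_dyB k n x : x <= 1 -> x <= 2 ^+ k * dy n -> x <= dy (n - k).
Proof.
move=> x1 xkn; have [kn|/ltnW nk] := leqP k n; first by rewrite -exp2_dyB.
by move: nk; rewrite -subn_eq0 => /eqP ->.
Qed.

Lemma dy_cvg0 : dy @ \oo --> (0 : R).
Proof. by apply: cvg_expr; rewrite ger0_norm ?invr_ge0// invf_lt1// ltr1n. Qed.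

Lemma near_mul_dy_le (c e : R) : 0 < e -> \forall k \near \oo, c * dy k <= e.
Proof.
move=> e0; have : (c * dy k) @[k --> \oo] --> (0 : R).
  by rewrite -(mulr0 c); apply: cvgMr; exact: dy_cvg0.
move/cvgrPdist_le/(_ e e0); apply: filterS => k; rewrite sub0r normrN.
exact: le_trans (ler_norm _).
Qed.

Lemma sum_dyB k n : \sum_(u < n) dy (u - k) <= k%:R + 2.
Proof.
suff : \sum_(u < n) dy (u - k) <= (minn n k)%:R + 2 - 2 * dy (n - k).
  have : (minn n k)%:R <= k%:R :> R by rewrite ler_nat geq_minr.
  have := dy_ge0 (n - k); lra.
elim: n => [|n IH]; first by rewrite big_ord0 min0n sub0n /dy expr0; lra.
rewrite big_ord_recr /=; have [kn|nk] := leqP k n.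
  move: IH; rewrite !(minn_idPr _) ?(leqW kn)// subSn// (dyS (n - k)); lra.
move: IH; rewrite !(minn_idPl _) ?(ltnW nk)//.
rewrite (eqP (ltnW nk)) (eqP nk) /dy expr0 -natr1; lra.
Qed.

Lemma sum_dy_divn b n : (0 < b)%N -> \sum_(u < n) dy (u %/ b) <= (2 * b)%:R.
Proof.
move=> b0; have blocks q : \sum_(0 <= u < b * q) dy (u %/ b) = b%:R * (2 - 2 * dy q).
  elim: q => [|q IH]; first by rewrite muln0 big_geq// /dy expr0 mulr1 subrr mulr0.
  have bqS : (b * q <= b * q.+1)%N by rewrite leq_mul2l leqnSn orbT.
  rewrite (big_cat_nat (leq0n _) bqS)/= IH.
  rewrite (@eq_big_nat _ _ _ _ _ _ (fun=> dy q)) => [|u /andP[qu uq]].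
    rewrite sumr_const_nat -mulnBr subSnn muln1 -mulr_natl (dyS q); ring.
  by rewrite (_ : u %/ b = q)%N//; apply/eqP; rewrite eqn_leq leq_divRL// -ltnS ltn_divLR//; lia.
have nbn : (n <= b * n)%N by rewrite leq_pmull.
rewrite -(big_mkord xpredT (fun u => dy (u %/ b))).
apply: (@le_trans _ _ (\sum_(0 <= u < b * n) dy (u %/ b))).
  by rewrite (big_cat_nat (leq0n _) nbn)/= lerDl sumr_ge0// => u _; exact: dy_ge0.
by rewrite blocks mulnC natrM ler_wpM2l// gerBl mulr_ge0 ?dy_ge0.
Qed.

Definition dyfloor k t : R := (Num.floor (2 ^+ k * t))%:~R * dy k.

Lemma dyfloor_le k t : dyfloor k t <= t.
Proof. by rewrite /dyfloor dyV ler_pdivrMr ?exprn_gt0// mulrC floor_le. Qed.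

Lemma lt_dyfloorD k t : t < dyfloor k t + dy k.
Proof.
rewrite -[X in _ + X]mul1r -mulrDl dyV ltr_pdivlMr ?exprn_gt0// mulrC.
by rewrite -[1]/(1%:~R) -intrD floorD1_gt.
Qed.

Lemma dyfloor_homo k : {homo dyfloor k : x y / x <= y}.
Proof.
by move=> x y xy; rewrite ler_pM2r ?dy_gt0// ler_int le_floor// ler_pM2l ?exprn_gt0.
Qed.

Lemma measurable_dyfloor k : measurable_fun setT (dyfloor k).
Proof. by apply: nondecreasing_measurable => //; exact: dyfloor_homo. Qed.

Lemma le_dyfloor k n t : (k <= n)%N -> dyfloor k t <= dyfloor n t.
Proof.
move=> kn; have dyk : dy k = (2 ^+ (n - k))%:~R * dy n :> R.
  by rewrite rmorphXn /= exp2_dyB ?leq_subr// subKn.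
rewrite /dyfloor dyk mulrA ler_pM2r ?dy_gt0// -intrM ler_int floor_ge_int intrM rmorphXn /= mulrC.
by rewrite -[in leRHS](subnK kn) exprD -mulrA ler_pM2l ?exprn_gt0// floor_le.
Qed.

End DyadicScales.

(** * Logarithms *)

Section Logarithms.
Context {R : realType}.
Implicit Types (c d r : R) (K : nat).

Lemma ln2_gt0 : 0 < ln 2 :> R. Proof. by rewrite ln_gt0 ?ltr1n. Qed.

Lemma near_ln_ge c : \forall n \near \oo, c <= ln n%:R.
Proof.
near=> n; rewrite -[leLHS]expRK.
have cn : expR c <= n%:R by near: n; exact: nbhs_infty_ger.
by rewrite ler_ln ?posrE ?expR_gt0// (lt_le_trans (expR_gt0 c)).
Unshelve. all: by end_near. Qed.

Lemma ln_exp2 K : ln (2 ^+ K) = K%:R * ln 2 :> R.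
Proof. by rewrite lnXn// mulr_natl. Qed.

Lemma ln_dy K : ln (dy K) = - (K%:R * ln 2) :> R.
Proof. by rewrite dyV lnV ?ln_exp2// posrE exprn_gt0. Qed.

Definition neglog d : \bar R := (maxe (- elog d%:E) 0)%E.

Lemma neglog_ge0 d : (0 <= neglog d)%E. Proof. by rewrite le_max lexx orbT. Qed.

Lemma neglog0 : neglog 0 = +oo%E. Proof. by rewrite /neglog /elog eqxx /= maxye. Qed.

Lemma neglog_gt0E d : 0 < d -> neglog d = (Num.max (- ln d) 0)%:E.
Proof. by move=> d0; rewrite /neglog /elog gt_eqF// -EFinN -EFin_max. Qed.

Lemma elog_expR_itv (x y : R) (V : \bar R) : ((expR x)%:E <= V <= (expR y)%:E)%E ->
  (x%:E <= elog V <= y%:E)%E.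
Proof.
case: V => [v| |] /andP[]; rewrite ?leye_eq ?leeNy_eq// !lee_fin => xv vy.
have v0 : 0 < v := lt_le_trans (expR_gt0 x) xv.
rewrite /elog gt_eqF// !lee_fin -[leLHS]expRK -[y]expRK.
by rewrite !ler_ln ?posrE ?expR_gt0// xv.
Qed.

Lemma measurable_elog : measurable_fun setT (fun d => elog d%:E).
Proof.
apply: measurable_fun_ifT => //=; first exact: measurable_fun_eqr.
by apply/measurable_EFinP; exact: measurable_ln.
Qed.

Lemma measurable_neglog : measurable_fun setT neglog.
Proof.
by apply: measurable_maxe => //; apply: measurableT_comp => //; exact: measurable_elog.
Qed.

Lemma natr_le_series_bool (p : nat -> bool) K : (forall u, (u < K)%N -> p u) ->
  ((K%:R : R)%:E <= \sum_(0 <= u <oo) ((p u)%:R)%:E)%E.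
Proof.
move=> pK; apply: (@le_trans _ _ (\sum_(0 <= u < K) ((p u)%:R)%:E)%E); last first.
  by apply: nneseries_lim_ge => u _ _; rewrite lee_fin.
rewrite big_mkord (eq_bigr (fun=> 1%E)) => [|u _]; last by rewrite pK.
by rewrite sumEFin lee_fin sumr_const card_ord.
Qed.

Lemma series_bool_eqy (p : nat -> bool) : (forall u, p u) ->
  (\sum_(0 <= u <oo) ((p u)%:R : R)%:E = +oo)%E.
Proof.
move=> pT; apply/eqyP => x _.
have [K xK] := filter_ex (nbhs_infty_ger x).
by apply: le_trans (natr_le_series_bool (K := K) _); rewrite ?lee_fin.
Qed.

Lemma neglog_le_dy c d K : 0 < c <= 1 -> c * dy K <= d ->
  (neglog d <= (- ln c + ln 2 * K%:R)%:E)%E.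
Proof.
move=> /andP[c0 c1] cd; have cK0 : 0 < c * dy K by rewrite mulr_gt0 ?dy_gt0.
have lc : ln c <= 0 by rewrite ln_le0.
rewrite neglog_gt0E ?(lt_le_trans cK0)// lee_fin ge_max; apply/andP; split; last first.
  by rewrite addr_ge0 ?oppr_ge0// mulr_ge0// ltW// ln2_gt0.
have : ln (c * dy K) <= ln d by rewrite ler_ln ?posrE ?(lt_le_trans cK0).
by rewrite lnM ?posrE ?dy_gt0// ln_dy; lra.
Qed.

Lemma neglog_layer_cake c d : 0 < c <= 1 -> 0 <= d ->
  (neglog d <= (- ln c)%:E + (ln 2)%:E * \sum_(0 <= u <oo) ((d < c * dy u)%R%:R)%:E)%E.
Proof.
move=> c01; have /andP[c0 _] := c01.
rewrite le_eqVlt => /predU1P[<-|d0].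
  rewrite neglog0 series_bool_eqy => [|u]; last by rewrite mulr_gt0 ?dy_gt0.
  by rewrite gt0_muley ?lte_fin ?ln2_gt0// addey.
have [K cKd Kmin] : exists2 K, c * dy K <= d & forall u, (u < K)%N -> d < c * dy u.
  have ex : exists K, c * dy K <= d by exact: filter_ex (near_mul_dy_le c d0).
  exists (ex_minn ex); case: ex_minnP => // K _ Kmin u uK.
  by rewrite ltNge; apply/negP => /Kmin; rewrite leqNgt uK.
apply: le_trans (neglog_le_dy c01 cKd) _.
by rewrite EFinD EFinM leeD2l// lee_pmul2l ?lte_fin ?ln2_gt0 ?natr_le_series_bool.
Qed.

(* The tangent to the convex function [x |-> expR (r * x)] at [- B], evaluated at [ln d]. *)
Lemma powR_ge_tangent r B d : 0 < r -> 0 <= d ->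
  ((expR (- (r * B)) * (1 + r * B))%:E <=
   (d `^ r)%:E + (expR (- (r * B)) * r)%:E * neglog d)%E.
Proof.
move=> r0; have E0 := expR_gt0 (- (r * B)).
rewrite le_eqVlt => /predU1P[<-|d0].
  by rewrite neglog0 gt0_muley ?lte_fin ?mulr_gt0// addey ?leey.
have lnd : - ln d <= Num.max (- ln d) 0 by rewrite le_max lexx.
rewrite neglog_gt0E// -EFinM -EFinD lee_fin /powR gt_eqF//.
apply: le_trans (lerD (lexx _) (ler_wpM2l _ lnd)); last by rewrite mulr_ge0 ?ltW.
rewrite (_ : r * ln d = - (r * B) + (r * ln d + r * B)); last by ring.
by rewrite expRD; have /(ler_wpM2l (ltW E0)) := expR_ge1Dx (r * ln d + r * B); lra.
Qed.

End Logarithms.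

(** * Euclidean distance and codebooks *)

Section SublevelSets.
Context {R : realType} {d : measure_display} {T : measurableType d}.
Variables (g : T -> R) (c : R).
Hypothesis mg : measurable_fun setT g.

Lemma measurable_sublevel_le : measurable [set t | g t <= c].
Proof.
have := mg measurableT (measurable_itv `]-oo, c]); rewrite setTI.
by congr measurable; apply/seteqP; split => t /=; rewrite in_itv.
Qed.

Lemma measurable_sublevel_lt : measurable [set t | g t < c].
Proof.
have := mg measurableT (measurable_itv `]-oo, c[); rewrite setTI.
by congr measurable; apply/seteqP; split => t /=; rewrite in_itv.
Qed.

End SublevelSets.

Lemma cauchy_schwarz_sum (R : realDomainType) (I : finType) (f g : I -> R) :
  (\sum_i f i * g i) ^+ 2 <= (\sum_i f i ^+ 2) * (\sum_i g i ^+ 2).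
Proof.
have mul_sums (p q : I -> R) : (\sum_i p i) * (\sum_i q i) = \sum_i \sum_j p i * q j.
  by rewrite big_distrl /=; apply: eq_bigr => i _; rewrite big_distrr.
have lagrange : \sum_i \sum_j (f i * g j - f j * g i) ^+ 2 =
    2 * ((\sum_i f i ^+ 2) * (\sum_i g i ^+ 2)) - 2 * (\sum_i f i * g i) ^+ 2.
  rewrite mulrDl mul1r {2}[_ * (\sum_i g i ^+ 2)]mulrC expr2 !mul_sums.
  rewrite mulr_sumr -sumrN -!big_split /=.
  apply: eq_bigr => i _; rewrite mulr_sumr -sumrN -!big_split /=.
  by apply: eq_bigr => j _; ring.
have : 0 <= \sum_i \sum_j (f i * g j - f j * g i) ^+ 2.
  by apply: sumr_ge0 => i _; apply: sumr_ge0 => j _; exact: sqr_ge0.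
rewrite lagrange; lra.
Qed.

Section EuclideanDistance.
Context {R : realType} {m : nat}.
Implicit Types (x y z a : 'rV[R]_m) (A : seq 'rV[R]_m) (r : R).

Lemma edist_ge0 x y : 0 <= edist x y. Proof. exact: sqrtr_ge0. Qed.

Lemma edist_sqr x y : edist x y ^+ 2 = \sum_(i < m) (x ord0 i - y ord0 i) ^+ 2.
Proof. by rewrite sqr_sqrtr// sumr_ge0// => i _; exact: sqr_ge0. Qed.

Lemma edistxx x : edist x x = 0.
Proof.
apply/eqP; rewrite -sqrf_eq0 edist_sqr big1// => i _.
by rewrite subrr expr0n.
Qed.

Lemma edist_eq0 x y : edist x y = 0 -> x = y.
Proof.
move/eqP; rewrite -sqrf_eq0 edist_sqr => /eqP/psumr_eq0P xy.
apply/rowP => i; apply/eqP; rewrite -subr_eq0 -sqrf_eq0 xy// => j _; exact: sqr_ge0.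
Qed.

Lemma edistC x y : edist x y = edist y x.
Proof. by congr Num.sqrt; apply: eq_bigr => i _; rewrite -sqrrN opprB. Qed.

Lemma edist_triangle y x z : edist x z <= edist x y + edist y z.
Proof.
rewrite -(@ler_pXn2r _ 2)// ?nnegrE ?addr_ge0 ?edist_ge0//.
have cs := cauchy_schwarz_sum (fun i => x ord0 i - y ord0 i) (fun i => y ord0 i - z ord0 i).
have : \sum_i (x ord0 i - y ord0 i) * (y ord0 i - z ord0 i) <= edist x y * edist y z.
  apply: le_trans (ler_norm _) _; rewrite -(@ler_pXn2r _ 2)// ?nnegrE ?mulr_ge0 ?edist_ge0//.
  by rewrite exprMn !edist_sqr real_normK ?num_real.
rewrite sqrrD !edist_sqr => inner_le.
rewrite (eq_bigr (fun i => (x ord0 i - y ord0 i) ^+ 2 + (y ord0 i - z ord0 i) ^+ 2 +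
   2 * ((x ord0 i - y ord0 i) * (y ord0 i - z ord0 i)))); last by move=> i _; ring.
rewrite !big_split /= -mulr_sumr -mulr_natl; lra.
Qed.

Lemma coord_le_edist x y i : `|x ord0 i - y ord0 i| <= edist x y.
Proof.
rewrite -(@ler_pXn2r _ 2)// ?nnegrE ?edist_ge0// edist_sqr real_normK ?num_real//.
by rewrite (bigD1 i)//= lerDl sumr_ge0// => j _; exact: sqr_ge0.
Qed.

Lemma edist_le_sum x y : edist x y <= \sum_(i < m) `|x ord0 i - y ord0 i|.
Proof.
rewrite -(@ler_pXn2r _ 2)// ?nnegrE ?edist_ge0 ?sumr_ge0// edist_sqr expr2 big_distrl /=.
apply: ler_sum => i _; rewrite -real_normK ?num_real// expr2 ler_wpM2l//.
by rewrite (bigD1 i)//= lerDl sumr_ge0.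
Qed.

Lemma lip1_edist a : lip1 (edist ^~ a).
Proof.
move=> x y; rewrite ler_norml; apply/andP; split.
  by have := edist_triangle x y a; rewrite (edistC y x); lra.
by have := edist_triangle y x a; lra.
Qed.

Lemma lip1_continuous (h : 'rV[R]_m -> R) : lip1 h -> continuous h.
Proof.
move=> lh x; have FF := @nbhs_filter _ x; apply/(@cvgrPdist_lt _ _ _ _ FF) => e e0.
pose d := e / m.+1%:R; have d0 : 0 < d by rewrite divr_gt0.
apply/nbhs_ballP; exists d => //= y [_ xy].
apply: le_lt_trans (lh x y) _; apply: le_lt_trans (edist_le_sum x y) _.
apply: (@le_lt_trans _ _ (\sum_(i < m) d)).
  by apply: ler_sum => i _; apply: ltW; exact: xy.
rewrite sumr_const card_ord -mulr_natl /d mulrA ltr_pdivrMr// mulrC ltr_pM2l//.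
by rewrite ltr_nat.
Qed.

Lemma continuous_measurable_to_Rm (g : R -> 'rV[R]_m) : continuous g ->
  measurable_fun setT (g : measurableTypeR R -> Rm R m).
Proof.
move=> /continuousP cg.
apply: (@measurability _ _ (measurableTypeR R) (Rm R m) setT g (@open 'rV[R]_m)) => // _ [B oB <-].
by rewrite setTI; apply: open_measurable; exact: cg.
Qed.

Lemma continuous_measurable_Rm (h : 'rV[R]_m -> R) : continuous h ->
  measurable_fun setT (h : Rm R m -> R).
Proof.
move=> /continuousP ch; apply: (measurability _ (RGenOpens.measurableE R)).
move=> _ [_ [a [b ->] <-]]; rewrite setTI; apply: sub_sigma_algebra.
exact/ch/interval_open.
Qed.

Lemma measurable_lip1 (h : 'rV[R]_m -> R) : lip1 h -> measurable_fun setT (h : Rm R m -> R).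
Proof. by move/lip1_continuous; exact: continuous_measurable_Rm. Qed.

Lemma measurable_edist a : measurable_fun setT (edist ^~ a : Rm R m -> R).
Proof. by apply: measurable_lip1; exact: lip1_edist. Qed.

Definition ecball a r : set 'rV[R]_m := [set y | edist y a <= r].

Lemma measurable_ecball a r : measurable (ecball a r : set (Rm R m)).
Proof. exact: (measurable_sublevel_le r (measurable_edist a)). Qed.

Lemma dA_le x A a : a \in A -> dA x A <= edist x a.
Proof. by move=> aA; exact: ge_bigmin_seq. Qed.

Lemma dA_ge0 x A : 0 <= dA x A.
Proof. by rewrite /dA; apply: le_bigmin => [|a _]; exact: edist_ge0. Qed.

Lemma dA_lt x A r : (0 < size A)%N -> dA x A < r -> exists2 a, a \in A & edist x a < r.
Proof.
case: A => // b A _ xA; apply: contrapT => far; move: xA; apply/negP; rewrite -leNgt.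
have le_edist a : a \in b :: A -> r <= edist x a.
  by move=> aA; rewrite leNgt; apply/negP => xa; apply: far; exists a.
by rewrite /dA big_seq; apply: le_bigmin => //=; apply: le_edist; rewrite inE eqxx.
Qed.

Lemma measurable_dA A : measurable_fun setT (dA ^~ A : Rm R m -> R).
Proof.
case: A => [|a A].
  by under eq_fun do rewrite /dA big_nil /= edistxx; exact: measurable_cst.
rewrite /dA /=; elim: (a :: A) => [|b B IH].
  by under eq_fun do rewrite big_nil; exact: measurable_edist.
under eq_fun do rewrite big_cons.
by apply: measurable_minr => //; exact: measurable_edist.
Qed.

Lemma measurable_neglog_dA A : measurable_fun setT (fun y : Rm R m => neglog (dA y A)).
Proof. exact: (measurableT_comp measurable_neglog (measurable_dA A)). Qed.

Lemma measurable_elog_dA A : measurable_fun setT (fun y : Rm R m => elog (dA y A)%:E).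
Proof. exact: (measurableT_comp measurable_elog (measurable_dA A)). Qed.

Lemma measurable_powR_dA A r : measurable_fun setT (fun y : Rm R m => ((dA y A) `^ r)%:E).
Proof.
apply/measurable_EFinP.
exact: (measurableT_comp (measurable_powR r) (measurable_dA A)).
Qed.

End EuclideanDistance.

(** * Hausdorff dimension *)

Definition fine_ball_covers {R : realType} {X : eqType} (dist : X -> X -> R) (s : R)
    (E : set X) : Prop :=
  forall e : R, 0 < e -> exists L : seq (X * R),
    [/\ forall c, c \in L -> 0 <= c.2 <= e,
        forall x, E x -> exists2 c, c \in L & dist x c.1 <= c.2 &
        \sum_(c <- L) (2 * c.2) `^ s <= e].

Section HausdorffDimension.
Context {R : realType} {m : nat}.
Implicit Types (s t delta r : R) (x y a : 'rV[R]_m) (E U : set 'rV[R]_m).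
Implicit Types (mu : probability (Rm R m) R).

Lemma hterm_ge0 s U : 0 <= hterm s U.
Proof. by rewrite /hterm; case: asboolP => // _; exact: powR_ge0. Qed.

Lemma hterm0 s : hterm s (set0 : set 'rV[R]_m) = 0.
Proof. by rewrite /hterm; case: asboolP. Qed.

Lemma edist_le_rdiam U delta x y : (forall x y, U x -> U y -> edist x y <= delta) ->
  U x -> U y -> edist x y <= rdiam U.
Proof.
move=> Udelta Ux Uy; apply: ub_le_sup; last by exists (x, y).
by exists delta => _ [[p q] [/= Up Uq] <-]; exact: Udelta.
Qed.

Lemma rdiam_le U delta x : U x -> (forall x y, U x -> U y -> edist x y <= delta) ->
  rdiam U <= delta.
Proof.
move=> Ux Udelta; apply: ge_sup; first by exists (edist x x), (x, x).
by move=> _ [[p q] [/= Up Uq] <-]; exact: Udelta.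
Qed.

Lemma edist_le_of_ecball a r x y : ecball a r x -> ecball a r y -> edist x y <= 2 * r.
Proof.
rewrite /ecball /= => xa ya.
by have := edist_triangle a x y; rewrite (edistC a y); lra.
Qed.

Lemma hterm_ecball s a r : 0 <= s -> 0 <= r -> hterm s (ecball a r) <= (2 * r) `^ s.
Proof.
move=> s0 r0; rewrite /hterm; case: asboolP => [_|/eqP/set0P[y ya]]; first exact: powR_ge0.
have diam := @edist_le_of_ecball a r.
apply: ge0_ler_powR => //; rewrite ?nnegrE ?mulr_ge0//; last exact: rdiam_le ya diam.
by rewrite -(edistxx y); exact: (edist_le_rdiam diam).
Qed.

Lemma Hdelta_ge0 s delta E : (0 <= Hdelta s delta E)%E.
Proof.
apply/ereal_infP => _ [U _ <-].
by apply: nneseries_ge0 => i _ _; rewrite lee_fin hterm_ge0.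
Qed.

Lemma Hdelta_le_balls s delta E (L : seq ('rV[R]_m * R)) : 0 <= s ->
  (forall c, c \in L -> 0 <= c.2 <= delta / 2) ->
  (forall x, E x -> exists2 c, c \in L & edist x c.1 <= c.2) ->
  (Hdelta s delta E <= (\sum_(c <- L) (2 * c.2) `^ s)%:E)%E.
Proof.
move=> s0 Lr LE; pose c i := nth (0, 0) L i.
pose U i := if (i < size L)%N then ecball (c i).1 (c i).2 else set0.
have cr i : (i < size L)%N -> 0 <= (c i).2 <= delta / 2 by move=> /(mem_nth (0, 0))/Lr.
have coverU : hcover delta E U.
  split=> [x /LE[b bL xb]|i x y]; last first.
    rewrite /U; case: ifP => // /cr radius xa ya.
    by apply: le_trans (edist_le_of_ecball xa ya) _; lra.
  by exists (index b L) => //; rewrite /U index_mem bL /ecball /= /c nth_index.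
apply: (@le_trans _ _ (\sum_(0 <= i <oo) (hterm s (U i))%:E)%E).
  by apply: ereal_inf_lbound; exists U.
apply: lime_le; first by apply: is_cvg_nneseries => i _ _; rewrite lee_fin hterm_ge0.
exists (size L) => // K /= LK.
rewrite (big_cat_nat (leq0n _) LK)/= [X in (_ + X)%E]big1_seq ?adde0; last first.
  move=> i; rewrite mem_index_iota => /andP[_ /andP[Li _]].
  by rewrite /U ltnNge Li /= hterm0.
rewrite sumEFin lee_fin (big_nth (0, 0)) !big_mkord; apply: ler_sum => i _.
by rewrite /U ltn_ord hterm_ecball//; case/andP: (cr i (ltn_ord i)).
Qed.

Lemma Hmeas_eq0 s E : 0 <= s -> fine_ball_covers (@edist R m) s E -> Hmeas s E = 0%E.
Proof.
move=> s0 covE; have Hdelta0 delta : 0 < delta -> Hdelta s delta E = 0%E.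
  move=> delta0; apply/eqP; rewrite eq_le Hdelta_ge0 andbT.
  apply/lee_addgt0Pr => e e0; rewrite add0e.
  have [L [Lr LE Ls]] := covE (Num.min e (delta / 2)) ltac:(by rewrite lt_min e0 divr_gt0).
  apply: le_trans (Hdelta_le_balls s0 _ LE) _ => [c /Lr|].
    by rewrite le_min => /and3P[-> _ ->].
  by rewrite lee_fin; apply: le_trans Ls _; rewrite ge_min lexx.
apply/eqP; rewrite eq_le; apply/andP; split.
  by apply/ereal_supP => _ [d /= d0 <-]; rewrite Hdelta0.
by apply: ereal_sup_ubound; exists 1 => //=; rewrite Hdelta0.
Qed.

Lemma dimH_le mu E s : measurable (E : set (Rm R m)) -> mu E = 1%E -> 0 <= s ->
  Hmeas s E = 0%E -> (dimH mu <= s%:E)%E.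
Proof.
move=> mE E1 s0 HE; apply: (@le_trans _ _ (dimH_set E)).
  by apply: ereal_inf_lbound; exists E.
by apply: ereal_inf_lbound; exists s.
Qed.

Lemma dimH_distribution_le {d} {T : measurableType d} (P : probability T R)
    (Y : {mfun T >-> Rm R m}) s : 0 <= s ->
  fine_ball_covers (@edist R m) s (range Y) -> (dimH (distribution P Y) <= s%:E)%E.
Proof.
move=> s0 covY.
have /choice[L LP] (p : nat) := covY _ (dy_gt0 p).
pose E : set (Rm R m) := \bigcap_p \bigcup_(c in [set` L p]) ecball c.1 c.2.
have mE : measurable E.
  apply: bigcapT_measurable => p; rewrite bigcup_seq.
  by apply: bigsetU_measurable => c _; exact: measurable_ecball.
apply: (dimH_le mE _ s0).
  suff YE : Y @^-1` E = setT by rewrite -[RHS](probability_setT P) -YE.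
  apply/seteqP; split=> // w _ p _; have [_ coverY _] := LP p.
  by have [|c cL Yc] := coverY (Y w); [exists w | exists c].
apply: Hmeas_eq0 => // e e0; have [p] := filter_ex (near_mul_dy_le 1 e0); rewrite mul1r => pe.
have [Lr _ Ls] := LP p; exists (L p); split.
- by move=> c /Lr /andP[-> cp]; exact: le_trans cp pe.
- by move=> x /(_ p Logic.I)[c cL xc]; exists c.
- exact: le_trans Ls pe.
Qed.

Lemma measure_le_series_hterm mu (C s t : R) E (U : nat -> set 'rV[R]_m) :
  0 <= C -> 0 <= t < s -> (forall a r, 0 <= r -> (mu (ecball a r) <= (C * r `^ s)%:E)%E) ->
  measurable (E : set (Rm R m)) -> hcover 1 E U ->
  (mu E <= C%:E * \sum_(0 <= i <oo) (hterm t (U i))%:E)%E.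
Proof.
move=> C0 /andP[t0 ts] muC mE [EU U1].
pose V i : set (Rm R m) := if `[< U i = set0 >] then set0 else ecball (xget 0 (U i)) (rdiam (U i)).
have UV i : U i `<=` V i.
  rewrite /V; case: asboolP => [->//|_] x Ux.
  by apply: (edist_le_rdiam (U1 i)) => //; exact: (xgetPex 0 (ex_intro _ x Ux)).
have mV i : measurable (V i).
  by rewrite /V; case: ifP => // _; exact: measurable_ecball.
have muV i : (mu (V i) <= C%:E * (hterm t (U i))%:E)%E.
  rewrite /V /hterm; case: asboolP => [_|/eqP/set0P[x Ux]]; first by rewrite measure0 mule0.
  have d0 : 0 <= rdiam (U i) by rewrite -(edistxx x); exact: (edist_le_rdiam (U1 i)).
  apply: le_trans (muC _ _ d0) _; rewrite -EFinM lee_fin ler_wpM2l//.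
  have := rdiam_le Ux (U1 i); move: d0; rewrite le_eqVlt => /predU1P[<- _|d0 d1].
    by rewrite powR0 ?powR_ge0// gt_eqF// (le_lt_trans t0).
  by apply: ger_powR; [rewrite d0 | exact: ltW].
have EV : E `<=` \bigcup_i V i by move=> x /EU[i _ /UV Vx]; exists i.
apply: le_trans (measure_sigma_subadditive mu mV mE EV) _.
rewrite -nneseriesZl => [|i _]; last by rewrite lee_fin hterm_ge0.
by apply: lee_nneseries => [i _ _|i _]; [exact: measure_ge0 | exact: muV].
Qed.

Lemma mass_distribution_principle mu (C s : R) :
  (forall a r, 0 <= r -> (mu (ecball a r) <= (C * r `^ s)%:E)%E) ->
  (s%:E <= dimH mu)%E.
Proof.
move=> muC; have C0 : 0 <= C.
  by have := le_trans (measure_ge0 mu _) (muC 0 1 ler01); rewrite lee_fin powR1 mulr1.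
apply/ereal_infP => _ [E [mE E1] <-]; apply/ereal_infP => _ [t [t0 HE] <-].
rewrite lee_fin leNgt; apply/negP => ts.
have C1 : 0 < C + 1 by rewrite ltr_wpDl.
have : (Hdelta t 1 E < ((C + 1)^-1)%:E)%E.
  apply: (@le_lt_trans _ _ (Hmeas t E)); last by rewrite HE lte_fin invr_gt0.
  by apply: ereal_sup_ubound; exists 1 => /=.
move=> /ereal_inf_lt[_ [U coverU <-] Ulow].
have ts' : 0 <= t < s by rewrite t0.
have := measure_le_series_hterm C0 ts' muC mE coverU; rewrite E1 leNgt => /negP; apply.
apply: (@le_lt_trans _ _ (C%:E * ((C + 1)^-1)%:E)%E); first by rewrite lee_wpmul2l ?lee_fin// ltW.
by rewrite -EFinM lte_fin ltr_pdivrMr// mul1r ltrDl.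
Qed.

End HausdorffDimension.

(** * Couplings *)

Lemma integral_cst_prob {R : realType} {d : measure_display} {T : measurableType d}
  (P : probability T R) (c : \bar R) : (\int[P]_w c = c)%E.
Proof.
by rewrite integral_cst// (_ : (P : measure T R) [set: T] = 1%E) ?mule1//; exact: probability_setT.
Qed.

Section Distributions.
Context {R : realType} {d d' : measure_display} {T : measurableType d} {T' : measurableType d'}.
Variables (P : probability T R) (Y : {mfun T >-> T'}).

Lemma integral_distributionE (f : T' -> \bar R) : measurable_fun setT f ->
  (\int[distribution P Y]_y f y = \int[P]_w f (Y w))%E.
Proof.
move=> mf; rewrite integralE [RHS]integralE; congr (_ - _)%E.
  by rewrite (funepos_comp f Y) ge0_integral_distribution//; exact: measurable_funepos.
by rewrite (funeneg_comp f Y) ge0_integral_distribution//; exact: measurable_funeneg.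
Qed.

Lemma integrable_distribution (f : T' -> \bar R) :
  (distribution P Y).-integrable setT f -> P.-integrable setT (f \o Y).
Proof.
move=> /integrableP[mf fy]; apply/integrableP; split; first exact: measurableT_comp.
by move: fy; rewrite ge0_integral_distribution//; exact: measurableT_comp.
Qed.

End Distributions.

Section Couplings.
Context {R : realType} {m : nat}.
Implicit Types (h : 'rV[R]_m -> R) (mu : probability (Rm R m) R).

Lemma lip1_integrable mu h : in_Omega mu -> lip1 h -> mu.-integrable setT (fun x => (h x)%:E).
Proof.
move=> imu lh; have mh : measurable_fun setT (fun x : Rm R m => (h x)%:E).
  by apply/measurable_EFinP; exact: measurable_lip1.
have med : measurable_fun setT (fun x : Rm R m => (edist x 0)%:E).
  by apply/measurable_EFinP; exact: measurable_edist.
apply/integrableP; split=> //.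
apply: (@le_lt_trans _ _ (\int[mu]_x ((edist x 0)%:E + (`|h 0|)%:E))%E).
  apply: ge0_le_integral => //; [exact: measurableT_comp|exact: emeasurable_funD|].
  move=> x _; rewrite abse_EFin -EFinD lee_fin -lerBlDr.
  by apply: le_trans (lh _ _); rewrite lerBlDr -{1}(subrK (h 0) (h x)) ler_normD.
rewrite ge0_integralD//; last by move=> x _; rewrite lee_fin edist_ge0.
by rewrite integral_cst_prob lte_add_pinfty// ltry.
Qed.

Lemma dL_coupling {d} {T : measurableType d} (P : probability T R) (X Y : {mfun T >-> Rm R m})
    mu (D : T -> \bar R) : (forall A, measurable A -> distribution P X A = mu A) ->
  in_Omega mu -> in_Omega (distribution P Y) ->
  measurable_fun setT D -> (forall w, ((edist (X w) (Y w))%:E <= D w)%E) ->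
  (dL mu (distribution P Y) <= \int[P]_w D w)%E.
Proof.
move=> muX imu inu mD XYD; apply/ereal_supP => _ [h lh <-].
have mh : measurable_fun setT (fun x : Rm R m => (h x)%:E).
  by apply/measurable_EFinP; exact: measurable_lip1.
have mu_law f : (\int[mu]_x f x = \int[distribution P X]_x f x)%E.
  by apply: eq_measure_integral => A mA _; apply/esym; exact: muX.
have iX : P.-integrable setT (fun w => (h (X w))%:E).
  apply: (integrable_distribution (Y := X) (f := EFin \o h)); apply: lip1_integrable => //.
  by rewrite /in_Omega -mu_law.
have iY : P.-integrable setT (fun w => (h (Y w))%:E).
  by apply: (integrable_distribution (Y := Y) (f := EFin \o h)); exact: lip1_integrable.
rewrite mu_law !integral_distributionE// -integralB_EFin//.
have mB : measurable_fun setT (fun w => (h (X w))%:E - (h (Y w))%:E)%E.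
  by apply: emeasurable_funB; [case/integrableP: iX|case/integrableP: iY].
apply: le_trans (le_abse_integral _ _ _) _ => //.
apply: ge0_le_integral => //; first exact: measurableT_comp.
by move=> w _; apply: le_trans (XYD w); rewrite -EFinB abse_EFin lee_fin lh.
Qed.

End Couplings.

(** * Quantization errors *)

Section LogarithmicIntegrals.
Context {R : realType} {d : measure_display} {T : measurableType d}.
Variables (P : probability T R) (g : T -> R).
Hypotheses (mg : measurable_fun setT g) (g0 : forall w, 0 <= g w).

Let measurable_neglog_g : measurable_fun setT (fun w => neglog (g w)).
Proof. exact: (measurableT_comp measurable_neglog mg). Qed.

Let measurable_powR_g (r : R) : measurable_fun setT (fun w => ((g w) `^ r)%:E).
Proof. by apply/measurable_EFinP; exact: (measurableT_comp (measurable_powR r) mg). Qed.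

(* Jensen's inequality for the exponential, without integrability of the logarithm. *)
Lemma expR_le_integral_powR (r B : R) : 0 < r -> (\int[P]_w neglog (g w) <= B%:E)%E ->
  ((expR (- (r * B)))%:E <= \int[P]_w ((g w) `^ r)%:E)%E.
Proof.
move=> r0 gB; have E0 := expR_gt0 (- (r * B)).
have B0 : 0 <= B.
  by rewrite -lee_fin; apply: le_trans gB; apply: integral_ge0 => w _; exact: neglog_ge0.
have Er0 : (0 <= (expR (- (r * B)) * r)%:E)%E by rewrite lee_fin mulr_ge0// ltW.
have tangent : ((expR (- (r * B)) * (1 + r * B))%:E <=
    \int[P]_w ((g w) `^ r)%:E + (expR (- (r * B)) * r)%:E * \int[P]_w neglog (g w))%E.
  rewrite -ge0_integralZl//; last by move=> w _; exact: neglog_ge0.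
  rewrite -ge0_integralD//; last 3 first.
  - by move=> w _; rewrite lee_fin powR_ge0.
  - by move=> w _; rewrite mule_ge0 ?neglog_ge0.
  - exact: emeasurable_funM.
  rewrite -[leLHS](integral_cst_prob P); apply: ge0_le_integral => //.
  - by move=> w _; rewrite lee_fin mulr_ge0 ?(ltW E0)// addr_ge0// mulr_ge0// ltW.
  - by apply: emeasurable_funD => //; exact: emeasurable_funM.
  - by move=> w _; exact: powR_ge_tangent.
rewrite (_ : expR (- (r * B)) = expR (- (r * B)) * (1 + r * B) - expR (- (r * B)) * r * B);
  last by ring.
rewrite EFinB leeBlDr//; apply: le_trans tangent _.
by rewrite leeD2l// (EFinM (_ * r) B) lee_wpmul2l.
Qed.

Lemma integral_neglog_le_series (c : R) : 0 < c <= 1 ->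
  (\int[P]_w neglog (g w) <=
   (- ln c)%:E + (ln 2)%:E * \sum_(0 <= u <oo) P [set w | (g w < c * dy u)%R])%E.
Proof.
move=> c01; pose D u := [set w | g w < c * dy u].
have mD u : measurable (D u) := measurable_sublevel_lt (c * dy u) mg.
have indE u w : (\1_(D u) w)%:E = ((g w < c * dy u)%R%:R)%:E :> \bar R by rewrite indicE mem_setE.
have l2 : (0 <= (ln 2 : R)%:E)%E by rewrite lee_fin ltW// ln2_gt0.
have lc : (0 <= (- ln c)%:E)%E by case/andP: c01 => c0 c1; rewrite lee_fin oppr_ge0 ln_le0.
have mind u : measurable_fun setT (fun w => (\1_(D u) w)%:E : \bar R).
  by apply/measurable_EFinP; exact: measurable_indic.
have mS : measurable_fun setT (fun w => \sum_(0 <= u <oo) (\1_(D u) w)%:E : \bar R)%E.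
  by apply: (ge0_emeasurable_sum (P := xpredT)) => [u w _ _|u _]; [rewrite lee_fin|exact: mind].
have S0 w : (0 <= \sum_(0 <= u <oo) (\1_(D u) w)%:E :> \bar R)%E.
  by apply: nneseries_ge0 => u _ _; rewrite lee_fin.
apply: (@le_trans _ _
    (\int[P]_w ((- ln c)%:E + (ln 2)%:E * \sum_(0 <= u <oo) (\1_(D u) w)%:E))%E).
  apply: ge0_le_integral => //.
  - by move=> w _; exact: neglog_ge0.
  - by apply: emeasurable_funD => //; exact: emeasurable_funM.
  - move=> w _; apply: le_trans (neglog_layer_cake c01 (g0 w)) _.
    by under [in leRHS]eq_eseriesr => u _ do rewrite indE.
rewrite ge0_integralD//; last 2 first.
- by move=> w _; rewrite mule_ge0.
- exact: emeasurable_funM.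
rewrite integral_cst_prob ge0_integralZl// integral_nneseries//.
have intD u : (\int[P]_w (\1_(D u) w)%:E = P (D u))%E by rewrite integral_indic// setIT.
by rewrite (eq_eseriesr (fun u _ => intD u)).
Qed.

Lemma oppe_le_integral_elog : (- (\int[P]_w neglog (g w)) <= \int[P]_w elog (g w)%:E)%E.
Proof.
rewrite [leRHS]integralE -[leLHS]sub0e; apply: leeB.
  by apply: integral_ge0 => w _; exact: funepos_ge0.
by rewrite le_eqVlt; apply/orP; left; apply/eqP/eq_integral => w _; rewrite funenegE.
Qed.

Lemma integral_elog_le (rho : R) : 0 < rho <= 1 -> (forall w, g w <= rho) ->
  (\int[P]_w elog (g w)%:E <= (ln rho)%:E)%E.
Proof.
move=> /andP[rho0 rho1] grho; have lrho : (0 <= (- ln rho)%:E)%E by rewrite lee_fin oppr_ge0 ln_le0.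
have elog_le w : ((- ln rho)%:E <= - elog (g w)%:E)%E.
  rewrite EFinN leeN2 /elog; case: eqP => [_|/eqP gw]; first exact: leNye.
  by rewrite lee_fin ler_ln// posrE lt_neqAle eq_sym gw g0.
have neglogE w : elog (g w)%:E = (- neglog (g w))%E.
  by rewrite /neglog max_l ?oppeK// (le_trans lrho).
rewrite (eq_integral _ _ (fun w _ => neglogE w)) integral_ge0N => [|w _]; last exact: neglog_ge0.
rewrite leeNl -EFinN -[leLHS](integral_cst_prob P); apply: ge0_le_integral => // w _.
by rewrite /neglog le_max elog_le.
Qed.

End LogarithmicIntegrals.

Section QuantizationBounds.
Context {R : realType} {m : nat}.
Implicit Types (n : nat) (r B rho : R) (A : seq 'rV[R]_m).

Lemma Vq_ge (nu : probability (Rm R m) R) n B r : 0 < r ->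
  (forall A, codebooks n A -> (\int[nu]_y neglog (dA y A) <= B%:E)%E) ->
  ((expR (- (r * B)))%:E <= Vq nu n r)%E.
Proof.
move=> r0 nuB; apply/ereal_infP => _ [A nA <-].
exact: (expR_le_integral_powR (measurable_dA A) (dA_ge0^~ A) r0 (nuB A nA)).
Qed.

Lemma logen_ge (nu : probability (Rm R m) R) n B :
  (forall A, codebooks n A -> (\int[nu]_y neglog (dA y A) <= B%:E)%E) ->
  ((- B)%:E <= logen nu n)%E.
Proof.
move=> nuB; apply/ereal_infP => _ [A nA <-].
apply: le_trans (oppe_le_integral_elog nu (dA^~ A)).
by rewrite EFinN leeN2; exact: nuB.
Qed.

Section Upper.
Context {d : measure_display} {T : measurableType d}.
Variables (P : probability T R) (Y : {mfun T >-> Rm R m}) (n : nat) (A : seq 'rV[R]_m) (rho : R).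
Hypotheses (nA : codebooks n A) (rho01 : 0 < rho <= 1) (Yrho : forall w, dA (Y w) A <= rho).

Let mdA : measurable_fun setT (fun w => dA (Y w) A).
Proof. exact: (measurableT_comp (measurable_dA A)). Qed.

Lemma Vq_distribution_le r : 0 < r -> (Vq (distribution P Y) n r <= (rho `^ r)%:E)%E.
Proof.
move=> r0; have [rho0 _] := andP rho01.
apply: (@le_trans _ _ (\int[distribution P Y]_y ((dA y A) `^ r)%:E)%E).
  by apply: ereal_inf_lbound; exists A.
rewrite integral_distributionE; last exact: measurable_powR_dA.
rewrite -[leRHS](integral_cst_prob P); apply: ge0_le_integral => //.
- by move=> w _; rewrite lee_fin powR_ge0.
- by apply/measurable_EFinP; exact: (measurableT_comp (measurable_powR r) mdA).
- by move=> w _; rewrite lee_fin ge0_ler_powR ?nnegrE ?dA_ge0 ?(ltW r0) ?(ltW rho0).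
Qed.

Lemma logen_distribution_le : (logen (distribution P Y) n <= (ln rho)%:E)%E.
Proof.
apply: (@le_trans _ _ (\int[distribution P Y]_y elog (dA y A)%:E)%E).
  by apply: ereal_inf_lbound; exists A.
rewrite integral_distributionE; last exact: measurable_elog_dA.
by apply: integral_elog_le => // w; exact: dA_ge0.
Qed.

End Upper.

End QuantizationBounds.

Section QuantizationDimensionOne.
Context {R : realType}.
Implicit Types (e r C : R) (n : nat).

Lemma ratio_cvg1 (X : nat -> \bar R) (y : nat -> R) : (\forall n \near \oo, 0 < y n) ->
  (forall e, 0 < e -> \forall n \near \oo, (((1 - e) * y n)%:E <= X n <= ((1 + e) * y n)%:E)%E) ->
  ((y n)%:E * (X n)^-1)%E @[n --> \oo] --> (1 : R)%:E.
Proof.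
move=> y0 Xy; pose q n := fine (X n) / y n.
have q1 : q @ \oo --> (1 : R).
  apply/cvgrPdist_le => e e0; near=> n.
  have yn : 0 < y n by near: n.
  have : (((1 - e) * y n)%:E <= X n <= ((1 + e) * y n)%:E)%E by near: n; exact: Xy.
  rewrite /q; case: (X n) => [x| |] /andP[]; rewrite ?leye_eq ?leeNy_eq ?lee_fin//= => x1 x2.
  by rewrite distrC ler_distl ler_pdivrMr// ler_pdivlMr// x1 x2.
have qV : (q n)^-1 @[n --> \oo] --> (1 : R) by rewrite -[X in _ --> X]invr1; exact: cvgV.
have qVE : ((q n)^-1)%:E @[n --> \oo] --> (1 : R)%:E by apply: cvg_EFin => //; near=> n.
apply: cvg_trans qVE; apply: near_eq_cvg; near=> n.
have yn : 0 < y n by near: n.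
have : (((1 - 2^-1) * y n)%:E <= X n <= ((1 + 2^-1) * y n)%:E)%E by near: n; exact: Xy.
rewrite /q; case: (X n) => [x| |] /andP[]; rewrite ?leye_eq ?leeNy_eq ?lee_fin//= => x1 _.
have x0 : 0 < x by apply: lt_le_trans x1; rewrite mulr_gt0//; lra.
by rewrite inver gt_eqF// -EFinM invf_div.
Unshelve. all: by end_near. Qed.

Lemma near_ln_div C e : 0 < C -> 0 < e -> \forall n \near \oo,
  (1 - e) * ln n%:R <= - ln (C / n%:R) /\ 0 < C / n%:R <= 1.
Proof.
move=> C0 e0; near=> n.
have n0 : 0 < n%:R :> R by near: n; exact: nbhs_infty_gtr.
have Cn : C <= n%:R by near: n; exact: nbhs_infty_ger.
have lnC : ln C / e <= ln n%:R by near: n; exact: near_ln_ge.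
split; last by rewrite divr_gt0//= ler_pdivrMr// mul1r.
by rewrite ln_div ?posrE//; move: lnC; rewrite ler_pdivrMr//; lra.
Unshelve. all: by end_near. Qed.

Context {m : nat}.

Definition log_error_le1 (nu : probability (Rm R m) R) : Prop :=
  forall e, 0 < e -> \forall n \near \oo, forall A, codebooks n A ->
    (\int[nu]_y neglog (dA y A) <= ((1 + e) * ln n%:R)%:E)%E.

Definition covered_by_codebooks {T : Type} (Y : T -> 'rV[R]_m) (C : R) : Prop :=
  \forall n \near \oo, exists2 A, codebooks n A & forall w, dA (Y w) A <= C / n%:R.

Context {d : measure_display} {T : measurableType d}.
Variables (P : probability T R) (Y : {mfun T >-> Rm R m}) (C : R).
Hypotheses (C0 : 0 < C) (logY : log_error_le1 (distribution P Y)) (covY : covered_by_codebooks Y C).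

Let near_quantizers e : 0 < e -> \forall n \near \oo, exists A rho,
  [/\ codebooks n A, 0 < rho <= 1, forall w, dA (Y w) A <= rho, (1 - e) * ln n%:R <= - ln rho &
      forall A, codebooks n A ->
        (\int[distribution P Y]_y neglog (dA y A) <= ((1 + e) * ln n%:R)%:E)%E].
Proof.
move=> e0; apply: filterS (filterI (logY e0) (filterI (near_ln_div C0 e0) covY)) => n.
by move=> [logn [[lnC C01] [A nA YA]]]; exists A, (C / n%:R).
Qed.

Let near_ln_gt0 : \forall n \near \oo, 0 < ln n%:R :> R.
Proof. by apply: filterS (near_ln_ge 1) => n; exact: lt_le_trans. Qed.

Lemma has_Dr1 r : 0 < r -> has_Dr (distribution P Y) r 1.
Proof.
move=> r0; rewrite /has_Dr /qratio; apply: ratio_cvg1 => [|e e0].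
  by apply: filterS near_ln_gt0 => n; exact: mulr_gt0.
apply: filterS (near_quantizers e0) => n [A [rho [nA rho01 Yrho lnrho logn]]].
have := Vq_distribution_le P nA rho01 Yrho r0; rewrite /powR gt_eqF; last by case/andP: rho01.
move=> Vle; have /elog_expR_itv/andP[lo hi] := introT andP (conj (Vq_ge r0 logn) Vle).
apply/andP; split.
  by rewrite leeNr -EFinN; apply: le_trans hi _; rewrite lee_fin mulrCA -mulrN ler_pM2l//; lra.
by rewrite leeNl -EFinN; apply: le_trans lo; rewrite lee_fin mulrCA.
Qed.

Lemma has_D01 : has_D0 (distribution P Y) 1.
Proof.
rewrite /has_D0 /qratio0; apply: ratio_cvg1 => [|e e0]; first exact: near_ln_gt0.
apply: filterS (near_quantizers e0) => n [A [rho [nA rho01 Yrho lnrho logn]]].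
apply/andP; split; last by rewrite leeNl -EFinN; exact: logen_ge.
rewrite leeNr -EFinN; apply: le_trans (logen_distribution_le P nA rho01 Yrho) _.
by rewrite lee_fin; lra.
Qed.

End QuantizationDimensionOne.

(** * Finite-valued rounding *)

Section ScalarRounding.
Context {R : realType}.
Implicit Types (z b : R) (k : nat).

Definition clamp b z : R := Num.max (- b) (Num.min b z).

Lemma clamp_id b z : `|z| <= b -> clamp b z = z.
Proof. by rewrite ler_norml => /andP[bz zb]; rewrite /clamp (min_idPr zb) (max_idPr bz). Qed.

Lemma clamp_itv b z : 0 <= b -> - b <= clamp b z <= b.
Proof. by move=> b0; rewrite /clamp le_max lexx /= ge_max ge_min lexx andbT ge0_cp. Qed.

Lemma dist_clamp b z : 0 <= b -> `|z - clamp b z| <= `|z|.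
Proof.
move=> b0; have [zb|bz] := leP `|z| b; first by rewrite clamp_id// subrr normr0.
rewrite /clamp; case: (ler0P z) bz => z0 bz.
  by rewrite (min_idPr _) ?(max_idPl _) ?ler0_norm//; lra.
by rewrite (min_idPl _) ?(max_idPr _) ?ger0_norm//; lra.
Qed.

Definition dyround k z : R := dyfloor k (clamp (2 ^+ k) z).

Lemma measurable_dyround k : measurable_fun setT (dyround k).
Proof.
apply: nondecreasing_measurable => // x y xy; apply: dyfloor_homo.
by rewrite /clamp ge_max !le_max lexx /= le_min !ge_min lexx xy !orbT.
Qed.

Lemma dyround_close k z : `|z| <= 2 ^+ k -> `|z - dyround k z| <= dy k.
Proof.
move=> zk; rewrite /dyround clamp_id//.
by have := dyfloor_le k z; have := lt_dyfloorD k z; rewrite ler_norml; lra.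
Qed.

Lemma dist_dyround k z : `|z - dyround k z| <= `|z| + 1.
Proof.
apply: le_trans (ler_distD (clamp (2 ^+ k) z) _ _) _; apply: lerD.
  by apply: dist_clamp; rewrite exprn_ge0.
rewrite /dyround; set c := clamp _ _.
have := dyfloor_le k c; have := lt_dyfloorD k c; have := dy_le1 (R := R) k.
by rewrite ler_norml; lra.
Qed.

Lemma dyround_grid k z : exists i : 'I_(2 * 4 ^ k).+1, dyround k z = i%:R * dy k - 2 ^+ k.
Proof.
rewrite /dyround; set c := clamp _ _; have /andP[c1 c2] : - 2 ^+ k <= c <= 2 ^+ k.
  by rewrite clamp_itv// exprn_ge0.
have e4 : (4 ^ k)%N%:R = 2 ^+ k * 2 ^+ k :> R by rewrite natrX -exprMn -natrM.
pose F := Num.floor (2 ^+ k * c).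
have F1 : - (4 ^ k)%N%:Z <= F by rewrite floor_ge_int intrN -pmulrn e4 -mulrN ler_pM2l ?exprn_gt0.
have F2 : F <= (4 ^ k)%N%:Z.
  rewrite -(ler_int R); apply: le_trans (floor_le _) _.
  by rewrite -pmulrn e4 ler_pM2l ?exprn_gt0.
have Fi : (absz (F + (4 ^ k)%N%:Z)%R < (2 * 4 ^ k).+1)%N by lia.
exists (Ordinal Fi) => /=; rewrite pmulrn gez0_abs; last by lia.
by rewrite intrD -pmulrn e4 mulrDl -mulrA exp2_dy mulr1 addrK.
Qed.

End ScalarRounding.

Section VectorRounding.
Context {R : realType} {m : nat}.
Implicit Types (x v : 'rV[R]_m) (k : nat).

Definition round_mx k x : 'rV[R]_m := map_mx (dyround k) x.

Definition round_range k : seq 'rV[R]_m :=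
  [seq \row_i ((f i)%:R * dy k - 2 ^+ k) | f : {ffun 'I_m -> 'I_(2 * 4 ^ k).+1}].

Lemma round_mx_range k x : round_mx k x \in round_range k.
Proof.
have [f fE] := choice (fun i => dyround_grid k (x ord0 i)).
apply/mapP; exists [ffun i => f i]; first by rewrite mem_enum.
by apply/rowP => i; rewrite !mxE fE ffunE.
Qed.

Lemma size_round_range_gt0 k : (0 < size (round_range k))%N.
Proof. by rewrite -has_predT; apply/hasP; exists (round_mx k 0) => //; exact: round_mx_range. Qed.

Lemma measurable_coord i : measurable_fun setT (fun x : Rm R m => (x : 'rV[R]_m) ord0 i).
Proof. by apply: continuous_measurable_Rm; exact: coord_continuous. Qed.

Lemma measurable_round_coord k i :
  measurable_fun setT (fun x : Rm R m => round_mx k x ord0 i).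
Proof.
under eq_fun do rewrite mxE.
exact: (measurableT_comp (measurable_dyround k) (measurable_coord i)).
Qed.

Lemma measurable_edist_coord {d} {T : measurableType d} (f g : T -> 'rV[R]_m) :
  (forall i, measurable_fun setT (fun w => f w ord0 i)) ->
  (forall i, measurable_fun setT (fun w => g w ord0 i)) ->
  measurable_fun setT (fun w => edist (f w) (g w)).
Proof.
move=> mf mg; apply: measurableT_comp => //.
  by apply: continuous_measurable_fun; exact: sqrt_continuous.
apply: measurable_sum => i; apply: measurable_funX.
exact: measurable_funB.
Qed.

Lemma measurable_round_err k : measurable_fun setT (fun x : Rm R m => edist x (round_mx k x)).
Proof.
by apply: measurable_edist_coord => i; [exact: measurable_coord|exact: measurable_round_coord].
Qed.

Lemma measurable_round_fiber k v : measurable ([set x | round_mx k x = v] : set (Rm R m)).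
Proof.
have mv : measurable_fun setT (fun x : Rm R m => edist (round_mx k x) v).
  by apply: measurable_edist_coord => i; [exact: measurable_round_coord|exact: measurable_cst].
have := mv measurableT _ (measurable_set1 0); rewrite setTI.
by congr measurable; apply/seteqP; split => x /=; [exact: edist_eq0|move=> ->; exact: edistxx].
Qed.

Lemma round_err_cvg0 x : (edist x (round_mx k x))%:E @[k --> \oo] --> (0 : \bar R)%E.
Proof.
apply: cvg_EFin; first by near=> k.
apply/cvgrPdist_le => e e0; near=> k; rewrite sub0r normrN ger0_norm ?edist_ge0//.
apply: le_trans (edist_le_sum _ _) (@le_trans _ _ (\sum_(i < m) dy k) _ _ _ _).
  apply: ler_sum => i _; rewrite mxE; apply: dyround_close.
  have xk : edist x 0 <= k%:R by near: k; exact: nbhs_infty_ger.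
  have := coord_le_edist x 0 i; rewrite mxE subr0 => /le_trans; apply; apply: le_trans xk _.
  by rewrite -natrX ler_nat ltnW// ltn_expl.
by rewrite sumr_const card_ord -[leLHS]mulr_natl; near: k; exact: near_mul_dy_le.
Unshelve. all: by end_near. Qed.

Lemma round_err_le k x : edist x (round_mx k x) <= m%:R * (edist x 0 + 1).
Proof.
apply: le_trans (edist_le_sum _ _) (@le_trans _ _ (\sum_(i < m) (edist x 0 + 1)) _ _ _ _).
  apply: ler_sum => i _; rewrite mxE; apply: le_trans (dist_dyround _ _) _; rewrite lerD2r.
  by have := coord_le_edist x 0 i; rewrite mxE subr0.
by rewrite sumr_const card_ord -[leLHS]mulr_natl.
Qed.

Lemma round_approx (mu : probability (Rm R m) R) (e : R) : in_Omega mu -> 0 < e ->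
  exists k, (\int[mu]_x (edist x (round_mx k x))%:E < e%:E)%E.
Proof.
move=> imu e0; pose g (x : Rm R m) := (m%:R%:E * ((edist x 0)%:E + 1))%E : \bar R.
have ig : mu.-integrable setT g.
  apply: integrableZl => //; apply: integrableD => //.
    by apply: (lip1_integrable (h := edist ^~ 0)) => //; exact: lip1_edist.
  exact: (finite_measure_integrable_cst mu 1).
have : (\int[mu]_x (edist x (round_mx k x))%:E)%E @[k --> \oo] --> (\int[mu]_x cst 0%E x)%E.
  apply: (@dominated_cvg _ _ _ mu setT measurableT _ _ g) => //.
  - by move=> k; apply/measurable_EFinP; exact: measurable_round_err.
  - by move=> x _; exact: round_err_cvg0.
  - by move=> k x _; rewrite abse_EFin ger0_norm ?edist_ge0// /g -EFinD -EFinM lee_fin round_err_le.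
rewrite integral_cst_prob => /fine_cvgP[err_fin /cvgrPdist_lt/(_ e e0) err_lt].
have [k [kfin klt]] := filter_ex (filterI err_fin err_lt).
exists k; rewrite -(fineK kfin) lte_fin; move: klt; rewrite /= sub0r normrN.
by apply: le_lt_trans; exact: ler_norm.
Qed.

End VectorRounding.

(** * Perturbation along a coordinate axis *)

Lemma measurable_fun_finite_section {d1 d2 d3} {T1 : measurableType d1} {T2 : measurableType d2}
    {T3 : measurableType d3} {V : choiceType} (g : T1 -> V) (s : seq V) (F : V -> T2 -> T3) :
  (forall x, g x \in s) -> (forall v, measurable [set x | g x = v]) ->
  (forall v, measurable_fun setT (F v)) ->
  measurable_fun setT (fun w : T1 * T2 => F (g w.1) w.2).
Proof.
move=> gs mg mF _ B mB; rewrite setTI.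
rewrite (_ : _ @^-1` B = \bigcup_(v in [set` s]) ([set x | g x = v] `*` (F v @^-1` B))).
  rewrite bigcup_seq; apply: bigsetU_measurable => v _; apply: measurableX; first exact: mg.
  by have := mF v measurableT _ mB; rewrite setTI.
apply/seteqP; split => -[x t] /=; first by move=> Bw; exists (g x) => //; exact: gs.
by move=> [v _ [/= <-]].
Qed.

Section AxisShift.
Context {R : realType} {m : nat}.
Variable i0 : 'I_m.
Implicit Types (v : 'rV[R]_m) (s t : R).

Definition axis_shift v s : 'rV[R]_m := v + s *: delta_mx ord0 i0.

Lemma axis_shift_coord v s : axis_shift v s ord0 i0 = v ord0 i0 + s.
Proof. by rewrite !mxE !eqxx mulr1. Qed.

Lemma axis_shift0 v : axis_shift v 0 = v.
Proof. by rewrite /axis_shift scale0r addr0. Qed.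

Lemma edist_axis_shift v s t : edist (axis_shift v s) (axis_shift v t) <= `|s - t|.
Proof.
apply: le_trans (edist_le_sum _ _) _.
rewrite (bigD1 i0)//= big1 => [|i /negbTE i0F]; last first.
  by rewrite !mxE i0F andbF !mulr0 subrr normr0.
by rewrite !axis_shift_coord addr0 opprD addrACA subrr add0r.
Qed.

Lemma measurable_axis_shift v : measurable_fun setT (axis_shift v : R -> Rm R m).
Proof.
apply: continuous_measurable_to_Rm => s.
by apply: cvgD; [exact: cvg_cst|exact: scalel_continuous].
Qed.

End AxisShift.

Section FstDistribution.
Context {R : realType} {d1 d2 : measure_display} {T1 : measurableType d1} {T2 : measurableType d2}.
Variables (P1 : probability T1 R) (P2 : probability T2 R).

HB.instance Definition _ := isMeasurableFun.Build _ _ _ _ (@fst T1 T2) measurable_fst.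

Lemma distribution_fst (A : set T1) : measurable A ->
  distribution (P1 \x P2)%E (@fst T1 T2) A = P1 A.
Proof.
move=> mA; have fstE : fst @^-1` A = A `*` [set: T2] by apply/seteqP; split => -[x t] //= [].
transitivity ((P1 \x P2)%E (A `*` [set: T2])); first by rewrite -fstE.
rewrite product_measure1E//.
by rewrite [X in (_ * X)%E](_ : _ = 1%E) ?mule1//; exact: (probability_setT P2).
Qed.

End FstDistribution.

Section Perturbation.
Context {R : realType} {m : nat} {d : measure_display} {T : measurableType d}.
Variables (P : probability T R) (f : {mfun T >-> R}) (i0 : 'I_m) (k : nat) (delta : R).

Definition perturb (w : Rm R m * T) : Rm R m := axis_shift i0 (round_mx k w.1) (delta * f w.2).

Let measurable_slice v : measurable_fun setT (fun t => axis_shift i0 v (delta * f t) : Rm R m).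
Proof.
apply: (measurableT_comp (measurable_axis_shift i0 v)).
exact: measurable_funM.
Qed.

Lemma measurable_perturb : measurable_fun setT perturb.
Proof.
exact: (measurable_fun_finite_section (T1 := Rm R m) (T3 := Rm R m)
  (F := fun v t => axis_shift i0 v (delta * f t))
  (round_mx_range k) (measurable_round_fiber k) measurable_slice).
Qed.

HB.instance Definition _ := isMeasurableFun.Build _ _ _ _ perturb measurable_perturb.

Variable mu : probability (Rm R m) R.

Definition perturbed : probability (Rm R m) R := distribution (mu \x P)%E perturb.

Lemma integral_perturbed_le (g : Rm R m -> \bar R) (B : \bar R) :
  measurable_fun setT g -> (forall y, (0 <= g y)%E) ->
  (forall v, (\int[P]_t g (axis_shift i0 v (delta * f t)) <= B)%E) ->
  (\int[perturbed]_y g y <= B)%E.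
Proof.
move=> mg g0 gB; have mgp := measurableT_comp mg measurable_perturb.
rewrite ge0_integral_distribution// fubini_tonelli1//; last by move=> w; exact: g0.
rewrite -[leRHS](integral_cst_prob mu); apply: ge0_le_integral => //.
- by move=> x _; apply: integral_ge0 => t _; exact: g0.
- by apply: measurable_fun_fubini_tonelli_F => // w; exact: g0.
- by move=> x _; exact: (gB (round_mx k x)).
Qed.

Lemma perturbed_le (A : set (Rm R m)) (B : \bar R) : measurable A ->
  (forall v, (P [set t | A (axis_shift i0 v (delta * f t))] <= B)%E) -> (perturbed A <= B)%E.
Proof.
move=> mA AB; rewrite -(setIT A) -integral_indic//; apply: integral_perturbed_le => [|y|v].
- by apply/measurable_EFinP; exact: measurable_indic.
- by rewrite lee_fin.
- have mAv : measurable [set t | A (axis_shift i0 v (delta * f t))].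
    by have := measurable_slice v measurableT mA; rewrite setTI.
  by apply: le_trans (AB v); rewrite -[X in (_ <= P X)%E]setIT -integral_indic.
Qed.

Section BoundedProfile.
Hypotheses (f1 : forall t, `|f t| <= 1) (delta0 : 0 <= delta).

Lemma edist_round_perturb w : edist (round_mx k w.1) (perturb w) <= delta.
Proof.
rewrite -[X in edist X _](axis_shift0 i0) edistC; apply: le_trans (edist_axis_shift _ _ _ _) _.
by rewrite subr0 normrM (ger0_norm delta0) ler_piMr.
Qed.

Lemma perturbed_in_Omega : in_Omega perturbed.
Proof.
pose C := \sum_(v <- round_range k) edist v (0 : 'rV[R]_m) + delta.
have bounded w : edist (perturb w) 0 <= C.
  apply: le_trans (edist_triangle (round_mx k w.1) _ _) _.
  rewrite addrC edistC lerD// edistC ?edist_round_perturb//.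
  rewrite (big_rem (round_mx k w.1)) ?round_mx_range//= edistC lerDl sumr_ge0// => v _.
  exact: edist_ge0.
have med : measurable_fun setT (fun y : Rm R m => (edist y 0)%:E).
  by apply/measurable_EFinP; exact: measurable_edist.
rewrite /in_Omega integral_distributionE//.
apply: (@le_lt_trans _ _ C%:E); last exact: ltry.
rewrite -[leRHS](integral_cst_prob (mu \x P)%E); apply: ge0_le_integral => //.
- by move=> w _; rewrite lee_fin edist_ge0.
- exact: (measurableT_comp med measurable_perturb).
- by move=> w _; rewrite lee_fin bounded.
Qed.

Lemma dL_perturbed (e : R) : in_Omega mu ->
  (\int[mu]_x (edist x (round_mx k x))%:E < e%:E)%E -> (dL mu perturbed < (e + delta)%:E)%E.
Proof.
move=> imu mue.
have merr : measurable_fun setT (fun x : Rm R m => (edist x (round_mx k x))%:E).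
  by apply/measurable_EFinP; exact: measurable_round_err.
have mD : measurable_fun setT (fun w : Rm R m * T => (edist w.1 (round_mx k w.1))%:E + delta%:E)%E.
  by apply: emeasurable_funD => //; exact: (measurableT_comp merr measurable_fst).
apply: le_lt_trans (dL_coupling (distribution_fst mu P) imu perturbed_in_Omega mD _) _ => [w|].
  rewrite -EFinD lee_fin; apply: le_trans (edist_triangle (round_mx k w.1) _ _) _.
  by rewrite lerD2l edist_round_perturb.
rewrite ge0_integralD//; last 2 first.
- by move=> w _; rewrite lee_fin edist_ge0.
- exact: (measurableT_comp merr measurable_fst).
rewrite integral_cst_prob EFinD lte_leD//.
rewrite -(integral_distributionE _ (@fst _ T) merr).
by rewrite (eq_measure_integral mu)// => A mA _; exact: distribution_fst.
Qed.

End BoundedProfile.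

End Perturbation.

(** * Dimensions of perturbed laws *)

Section NearSeq.
Context {R : realType}.
Implicit Types (s : seq R) (r a t : R).

Definition near_seq s r : set R := [set t | has (fun a => `|t - a| < r) s].

Lemma near_seq_cons a s r : near_seq (a :: s) r = ball a r `|` near_seq s r.
Proof.
by apply/seteqP; split => t /=; rewrite /near_seq /= /ball /= distrC => /orP.
Qed.

Lemma near_seq_nil r : near_seq [::] r = set0. Proof. by apply/seteqP; split. Qed.

Lemma measurable_near_seq s r : measurable (near_seq s r).
Proof.
elim: s => [|a s IH]; first by rewrite near_seq_nil.
by rewrite near_seq_cons; apply: measurableU => //; exact: measurable_ball.
Qed.

Lemma near_seq_homo s r r' : r <= r' -> near_seq s r `<=` near_seq s r'.
Proof. by move=> rr' t /hasP[a aS ta]; apply/hasP; exists a => //; exact: lt_le_trans rr'. Qed.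

Lemma lebesgue_near_seq_le s r : 0 <= r ->
  (lebesgue_measure (near_seq s r) <= ((size s)%:R * (2 * r))%:E)%E.
Proof.
move=> r0; elim: s => [|a s IH]; first by rewrite near_seq_nil measure0 mul0r.
rewrite near_seq_cons; apply: le_trans (measureU2 _ _ _) _.
- exact: measurable_ball.
- exact: measurable_near_seq.
apply: le_trans (leeD2l _ IH) _.
rewrite [X in (X + _)%E](_ : _ = (r *+ 2)%:E); last exact: lebesgue_measure_ball.
by rewrite -EFinD lee_fin /= -natr1 -mulr_natl; lra.
Qed.

End NearSeq.

Section MeasurablePreimages.
Context {R : realType} {d : measure_display} {T : measurableType d}.
Implicit Types (f : {mfun T >-> R}) (s : seq R) (a r : R).

Lemma measurable_preimage_near_seq f s r : measurable (f @^-1` near_seq s r).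
Proof. by have := measurable_funPT f measurableT _ (measurable_near_seq s r); rewrite setTI. Qed.

Lemma measurable_dist_le f a r : measurable [set t | `|f t - a| <= r].
Proof.
apply: (measurable_sublevel_le (g := fun t => `|f t - a|)).
by apply: measurableT_comp => //; exact: measurable_funB.
Qed.

End MeasurablePreimages.

(* With [n] balls of radius [2 ^ (- u)] one can only catch a non-negligible mass at about [log_2 n]
   scales [u]. *)
Definition spread {R : realType} {d} {T : measurableType d} (P : probability T R)
    (f : T -> R) : Prop :=
  forall e : R, 0 < e -> \forall n \near \oo, forall s : seq R, (size s <= n)%N ->
    ((ln 2)%:E * \sum_(0 <= u <oo) P (f @^-1` near_seq s (dy u)) <= ((1 + e) * ln n%:R)%:E)%E.

Definition midpoint {R : realType} (g i : nat) : R := (2 * i).+1%:R / g%:R - 1.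

Lemma midpoint_close {R : realType} (g : nat) (y : R) : (0 < g)%N -> `|y| <= 1 ->
  exists2 i, (i < g)%N & `|y - midpoint g i| <= g%:R^-1.
Proof.
move=> g0; have gR : 0 < g%:R :> R by rewrite ltr0n.
have distE i : `|y - midpoint g i| = `|g%:R * (y + 1) - (2 * i).+1%:R| / g%:R.
  rewrite /midpoint -[X in _ = _ / X](gtr0_norm gR) -normfV -normrM; congr (`|_|).
  by move: (2 * i).+1%:R (g%:R) gR => N G G0; field; rewrite gt_eqF.
have oddE i : (2 * i).+1%:R = 2 * i%:R + 1 :> R by rewrite -natr1 natrM.
rewrite ler_norml => /andP[y1]; rewrite le_eqVlt => /predU1P[yE|y2].
  exists g.-1; first by rewrite prednK.
  rewrite distE yE ler_pdivrMr// mulVf ?gt_eqF// oddE -{1}(prednK g0) -natr1.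
  by rewrite ler_norml; lra.
pose z := g%:R * ((y + 1) / 2).
have z0 : 0 <= z by rewrite mulr_ge0 ?ler0n// divr_ge0//; lra.
have zg : z < g%:R by rewrite -[ltRHS]mulr1 ltr_pM2l//; lra.
have [i1 i2] := andP (truncn_itv z0); set i := Num.truncn z in i1 i2.
exists i; first by rewrite -(ltr_nat R); exact: le_lt_trans zg.
rewrite distE ler_pdivrMr// mulVf ?gt_eqF// oddE.
rewrite (_ : g%:R * (y + 1) = 2 * z); last by rewrite /z; field.
by move: i2; rewrite -natr1 ler_norml; lra.
Qed.

Lemma fine_ball_covers_bounded {R : realType} {T : Type} (f : T -> R) (s : R) : 1 < s ->
  (forall t, `|f t| <= 1) -> fine_ball_covers (fun x y => `|x - y|) s (range f).
Proof.
move=> s1 f1 e e0; have s10 : 0 < s - 1 by rewrite subr_gt0.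
pose h := (e / 2) `^ (s - 1)^-1; have h0 : 0 < h by rewrite powR_gt0 ?divr_gt0.
have [g [g0 ge gh]] : exists g : nat, [/\ (0 < g)%N, g%:R^-1 <= e & 2 * g%:R^-1 <= h].
  apply: (@filter_ex _ (nbhs \oo)); near=> g.
  have g0 : 0 < g%:R :> R by near: g; exact: nbhs_infty_gtr.
  split; first by rewrite -(ltr_nat R).
    by rewrite -[e]invrK lef_pV2 ?posrE ?invr_gt0//; near: g; exact: nbhs_infty_ger.
  rewrite ler_pdivrMr// -ler_pdivrMl//; near: g; exact: nbhs_infty_ger.
have gR : 0 < g%:R :> R by rewrite ltr0n.
exists [seq (midpoint g i, g%:R^-1) | i <- iota 0 g]; split.
- by move=> _ /mapP[i _ ->] /=; rewrite ge invr_ge0 ler0n.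
- move=> _ [t _ <-]; have [i ig fi] := midpoint_close g0 (f1 t).
  by exists (midpoint g i, g%:R^-1) => //; apply/mapP; exists i; rewrite ?mem_iota.
rewrite big_map /= big_const_seq count_predT size_iota iter_addr_0 -[leLHS]mulr_natl /=.
pose q : R := 2 * g%:R^-1; have q0 : 0 < q by rewrite mulr_gt0 ?invr_gt0.
have qs : q `^ s = q `^ (s - 1) * q.
  by rewrite -[X in _ * X]powRr1 ?(ltW q0)// -powRD ?subrK// (gt_eqF q0) implybT.
rewrite -/q qs mulrCA [_ * q]mulrCA mulfV ?gt_eqF// mulr1 -ler_pdivlMr//.
have <- : h `^ (s - 1) = e / 2.
  by rewrite -powRrM mulVf ?lt0r_neq0// powRr1// ltW// divr_gt0.
by apply: ge0_ler_powR; rewrite ?nnegrE ?(ltW s10) ?(ltW q0) ?(ltW h0).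
Unshelve. all: by end_near. Qed.

Section PerturbedDimensions.
Context {R : realType} {m : nat} {d : measure_display} {T : measurableType d}.
Variables (P : probability T R) (f : {mfun T >-> R}) (i0 : 'I_m) (k : nat) (delta : R).
Variable mu : probability (Rm R m) R.
Hypothesis delta01 : 0 < delta <= 1.
Local Notation nu := (perturbed P f i0 k delta mu).
Local Notation K := (size (round_range (R := R) (m := m) k)).

Let delta0 : 0 < delta. Proof. by case/andP: delta01. Qed.

Let delta1 : delta <= 1. Proof. by case/andP: delta01. Qed.

Let K0 : (0 < K)%N. Proof. exact: size_round_range_gt0. Qed.

Lemma edist_axis_shift_mul_le (v : 'rV[R]_m) (t t' : R) :
  edist (axis_shift i0 v (delta * t)) (axis_shift i0 v (delta * t')) <= `|t - t'|.
Proof.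
apply: le_trans (edist_axis_shift _ _ _ _) _.
by rewrite -mulrBr normrM (gtr0_norm delta0) ler_piMl.
Qed.

Lemma mul_dist_le_edist_axis_shift (v a : 'rV[R]_m) (t : R) :
  delta * `|t - (a ord0 i0 - v ord0 i0) / delta| <= edist (axis_shift i0 v (delta * t)) a.
Proof.
apply: le_trans (coord_le_edist _ _ i0); rewrite axis_shift_coord.
have -> : v ord0 i0 + delta * t - a ord0 i0 = delta * (t - (a ord0 i0 - v ord0 i0) / delta).
  by field; rewrite gt_eqF.
by rewrite normrM (gtr0_norm delta0).
Qed.

Lemma dA_axis_shift_near (v : 'rV[R]_m) (A : seq 'rV[R]_m) (r t : R) : (0 < size A)%N ->
  dA (axis_shift i0 v (delta * t)) A < delta * r ->
  near_seq [seq (a ord0 i0 - v ord0 i0) / delta | a : 'rV[R]_m <- A] r t.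
Proof.
move=> A0 /(dA_lt A0)[a aA near_a]; apply/hasP.
exists ((a ord0 i0 - v ord0 i0) / delta); first exact: map_f.
by rewrite -(ltr_pM2l delta0); exact: le_lt_trans (mul_dist_le_edist_axis_shift _ _ _) near_a.
Qed.

Lemma log_error_le1_perturbed : spread P f -> log_error_le1 nu.
Proof.
move=> spreadf e e0; have e20 : 0 < e / 2 by rewrite divr_gt0.
near=> n => A /andP[A0 An].
have lnd : - ln delta <= e / 2 * ln n%:R.
  by rewrite -ler_pdivrMl// mulrC; near: n; exact: near_ln_ge.
apply: integral_perturbed_le => [|y|v]; [exact: measurable_neglog_dA|exact: neglog_ge0|].
pose s := [seq (a ord0 i0 - v ord0 i0) / delta | a : 'rV[R]_m <- A].
have mslice : measurable_fun setT (fun t => dA (axis_shift i0 v (delta * f t)) A).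
  apply: (measurableT_comp (measurable_dA A)).
  by apply: (measurableT_comp (measurable_axis_shift i0 v)); exact: measurable_funM.
apply: le_trans (integral_neglog_le_series P mslice (fun=> dA_ge0 _ _) delta01) _.
have near_s : (\sum_(0 <= u <oo)
    P [set t | (dA (axis_shift i0 v (delta * f t)) A < delta * dy u)%R] <=
    \sum_(0 <= u <oo) P (f @^-1` near_seq s (dy u)))%E.
  apply: lee_nneseries => // u _; apply: le_measure; rewrite ?inE.
  - exact: (measurable_sublevel_lt (delta * dy u) mslice).
  - exact: measurable_preimage_near_seq.
  - by move=> t; exact: dA_axis_shift_near.
have spread_s : ((ln 2)%:E * \sum_(0 <= u <oo) P (f @^-1` near_seq s (dy u)) <=
    ((1 + e / 2) * ln n%:R)%:E)%E.
  have : (size s <= n)%N by rewrite size_map.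
  by move: (s); near: n; exact: spreadf.
have ln20 : (0 <= (ln 2 : R)%:E)%E by rewrite lee_fin ltW// ln2_gt0.
apply: le_trans (leeD (lexx _) (le_trans (lee_wpmul2l ln20 near_s) spread_s)) _.
by rewrite -EFinD lee_fin; lra.
Unshelve. all: by end_near. Qed.

Hypothesis f1 : forall t, `|f t| <= 1.

Lemma perturb_covered_by_codebooks : covered_by_codebooks (perturb f i0 k delta) (2 * K%:R).
Proof.
exists K => // n /= Kn; pose g := (n %/ K)%N; have g0 : (0 < g)%N by rewrite divn_gt0.
exists [seq axis_shift i0 v (delta * midpoint g i) | v <- round_range k, i <- iota 0 g].
  by rewrite /codebooks /= size_allpairs size_iota muln_gt0 K0 g0 mulnC leq_divM.
move=> w; have [i ig fi] := midpoint_close g0 (f1 w.2).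
have wA := allpairs_f (fun v i => axis_shift i0 v (delta * midpoint g i))
  (round_mx_range k w.1) (etrans (mem_iota 0 g i) ig).
apply: le_trans (dA_le _ wA) (le_trans (edist_axis_shift_mul_le _ _ _) _).
apply: le_trans fi _.
have n0 : (0 < n)%N := leq_trans K0 Kn.
rewrite -div1r ler_pdivrMr ?ltr0n// mulrAC ler_pdivlMr ?ltr0n// mul1r -!natrM ler_nat.
have := ltn_ceil n K0; rewrite -/g; have : (K <= K * g)%N by rewrite leq_pmulr.
by rewrite mulSn -mulnA mulnC; lia.
Qed.

Lemma perturbed_dimension1 : spread P f -> (forall r, 0 < r -> has_Dr nu r 1) /\ has_D0 nu 1.
Proof.
move=> /log_error_le1_perturbed lognu; have C0 : 0 < 2 * K%:R :> R by rewrite mulr_gt0 ?ltr0n.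
have covnu := perturb_covered_by_codebooks.
by split=> [r r0|]; [exact: has_Dr1 C0 lognu covnu r r0|exact: has_D01 C0 lognu covnu].
Qed.

Lemma dimH_perturbed_le (s : R) : 0 <= s ->
  fine_ball_covers (fun x y => `|x - y|) s (range f) -> (dimH nu <= s%:E)%E.
Proof.
move=> s0 coverf; apply: dimH_distribution_le => // e e0.
have KR : 1 <= K%:R :> R by rewrite ler1n.
have eK : 0 < e / K%:R by rewrite divr_gt0// (lt_le_trans ltr01).
have [L [Lr Lf Ls]] := coverf _ eK.
exists [seq (axis_shift i0 v (delta * c.1), c.2) | v <- round_range k, c <- L]; split.
- move=> _ /allpairsP[[v c] [_ /Lr/andP[c0 ce] ->]] /=; rewrite c0; apply: le_trans ce _.
  by rewrite ler_pdivrMr ?(lt_le_trans ltr01)// ler_peMr// ltW.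
- move=> _ [w _ <-]; have [|c cL fc] := Lf (f w.2); first by exists w.2.
  exists (axis_shift i0 (round_mx k w.1) (delta * c.1), c.2).
    by apply/allpairsP; exists (round_mx k w.1, c); rewrite round_mx_range.
  exact: le_trans (edist_axis_shift_mul_le _ _ _) fc.
- rewrite big_allpairs_dep /= big_const_seq count_predT iter_addr_0 -[leLHS]mulr_natl.
  by rewrite -ler_pdivlMl ?(lt_le_trans ltr01)// mulrC.
Qed.

Lemma dimH_perturbed_ge (C s : R) :
  (forall a r : R, 0 <= r -> (P [set t | (`|f t - a| <= r)%R] <= (C * r `^ s)%:E)%E) ->
  (s%:E <= dimH nu)%E.
Proof.
move=> Pball; apply: (mass_distribution_principle (C := C * delta^-1 `^ s)) => a r r0.
apply: perturbed_le => [|v]; first exact: measurable_ecball.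
have rd0 : 0 <= r / delta by rewrite divr_ge0// ltW.
rewrite mulrAC -mulrA -powRM ?invr_ge0// ?(ltW delta0)//.
apply: le_trans (Pball ((a ord0 i0 - v ord0 i0) / delta) _ rd0).
apply: le_measure; rewrite ?inE.
- have mslice := measurableT_comp (measurable_axis_shift i0 v)
    (measurable_funM (measurable_cst delta) (measurable_funPT f)).
  by have := mslice measurableT _ (measurable_ecball a r); rewrite setTI.
- exact: measurable_dist_le.
move=> t /= ta; rewrite ler_pdivlMr// mulrC.
exact: le_trans (mul_dist_le_edist_axis_shift _ _ _) ta.
Qed.

End PerturbedDimensions.

(** * Profiles of a uniform variable *)

Lemma spread_of_exp2 {R : realType} {d} {T : measurableType d} (P : probability T R) (f : T -> R) :
  (forall e : R, 0 < e -> exists C : R, \forall U \near \oo, forall s : seq R,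
     (size s <= 2 ^ U)%N ->
     (\sum_(0 <= u <oo) P (f @^-1` near_seq s (dy u)) <= ((1 + e) * U%:R + C)%:E)%E) ->
  spread P f.
Proof.
move=> fU e e0; have e20 : 0 < e / 2 by rewrite divr_gt0.
have [C [N _ fN]] := fU _ e20.
near=> n => s sn; pose U := (trunc_log 2 n).+1.
have n0 : (0 < n)%N by near: n; exists 1.
have NU : (N <= U)%N.
  by apply: leqW; apply: trunc_log_max => //; near: n; exists (2 ^ N)%N.
have sU : (size s <= 2 ^ U)%N by apply: leq_trans sn (ltnW _); exact: trunc_log_ltn.
have lnC : ln 2 * (1 + e / 2 + C) <= e / 2 * ln n%:R.
  by rewrite -ler_pdivrMl//; near: n; exact: near_ln_ge.
have lnU : (U%:R - 1) * ln 2 <= ln n%:R :> R.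
  rewrite /U -natr1 addrK -ln_exp2 ler_ln ?posrE ?exprn_gt0 ?ltr0n// -natrX ler_nat.
  exact: trunc_logP.
have ln20 := ln2_gt0 (R := R).
apply: le_trans (lee_wpmul2l _ (fN U NU s sU)) _; first by rewrite lee_fin ltW.
rewrite -EFinM lee_fin.
have /(ler_wpM2l (ltW (addr_gt0 ltr01 e20))) := lnU; move: lnC; nra.
Unshelve. all: by end_near. Qed.

Section UniformProfiles.
Context {R : realType}.
Local Notation lambda := (@lebesgue_measure R).
Implicit Types (t : R) (A B : set R) (s : seq R).

Definition unif : probability (measurableTypeR R) R := uniform_prob (@ltr01 R).

Lemma unif_le A B : measurable A -> measurable B ->
  (forall t, 0 <= t < 1 -> A t -> B t) -> (unif A <= lambda B)%E.
Proof.
move=> mA mB AB; rewrite /unif /= /uniform_prob integral_uniform_pdf.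
have mA1 : measurable (A `&` `[0, 1]) by exact: measurableI.
apply: (@le_trans _ _ (\int[lambda]_(x in A `&` `[0%R, 1%R]) (cst 1 x))%E).
  apply: ge0_le_integral => //.
  - by move=> x _; rewrite lee_fin uniform_pdf_ge0.
  - by apply/measurable_EFinP/measurable_funTS; exact: measurable_uniform_pdf.
  - by move=> x [_]; rewrite /= in_itv /= /uniform_pdf => ->; rewrite subr0 invr1.
rewrite integral_cst// mul1e.
apply: (@le_trans _ _ (lambda (B `|` [set 1]))).
  apply: le_measure; rewrite ?inE//; first exact: measurableU.
  move=> t [At] /=; rewrite in_itv /= => /andP[t0].
  rewrite le_eqVlt => /predU1P[->|t1]; first by right.
  by left; apply: AB => //; rewrite t0.
apply: le_trans (measureU2 _ _ _) _ => //.
by rewrite [X in (_ + X)%E](_ : _ = 0%E) ?adde0//; exact: lebesgue_measure_set1.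
Qed.

Lemma unif_near_seq_le A s (X j u : nat) : measurable A -> (size s <= 2 ^ X)%N ->
  (forall t, 0 <= t < 1 -> A t -> near_seq s (2 ^+ j * dy u) t) ->
  (unif A <= (dy (u - (X + j).+1))%:E)%E.
Proof.
move=> mA sX As; have unif1 : (unif A <= 1)%E := probability_le1 unif mA.
have r0 : 0 <= 2 ^+ j * dy u :> R by rewrite mulr_ge0 ?dy_ge0 ?exprn_ge0.
have := le_trans (unif_le mA (measurable_near_seq s _) As) (lebesgue_near_seq_le s r0).
rewrite -(fineK (fin_num_measure unif A mA)) !lee_fin in unif1 * => unif_s.
apply: le_dyB => //; apply: le_trans unif_s _.
rewrite exprS exprD -!mulrA mulrCA ler_pM2l// !mulrA -[leRHS]mulrA -mulrA ler_wpM2r//.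
by rewrite -natrX ler_nat.
Qed.

Definition on_unit (g : R -> R) : measurableTypeR R -> R :=
  fun t => if 0 <= t < 1 then g t else 0.

Lemma measurable_on_unit g : measurable_fun setT g -> measurable_fun setT (on_unit g).
Proof.
move=> mg; apply: measurable_fun_ifT => //.
by apply: measurable_and; [exact: measurable_fun_ler|exact: measurable_fun_ltr].
Qed.

Definition unit_id := on_unit id.

HB.instance Definition _ :=
  isMeasurableFun.Build _ _ _ _ unit_id (measurable_on_unit (@measurable_id _ _ setT)).

Lemma unit_id_le1 t : `|unit_id t| <= 1.
Proof.
by rewrite /unit_id /on_unit; case: ifP => [/andP[t0 t1]|_]; rewrite ?normr0// ger0_norm// ltW.
Qed.

Lemma spread_unit_id : spread unif unit_id.
Proof.
apply: spread_of_exp2 => e e0; exists 3; near=> U => s sU.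
apply: lime_le; first by apply: is_cvg_nneseries => n _ _; exact: measure_ge0.
near=> n; rewrite big_mkord.
have near_s u : (unif (unit_id @^-1` near_seq s (dy u)) <= (dy (u - (U + 0).+1))%:E)%E.
  apply: unif_near_seq_le sU _ => [|t t01].
    exact: measurable_preimage_near_seq.
  by rewrite expr0 mul1r /preimage /= /unit_id /on_unit t01.
apply: le_trans (lee_sum _ (fun (u : 'I_n) _ => near_s u)) _.
rewrite sumEFin lee_fin; apply: le_trans (sum_dyB _ _) _.
have := mulr_ge0 (ltW e0) (ler0n R U); rewrite addn0 -natr1; lra.
Unshelve. all: by end_near. Qed.

Lemma unif_unit_id_ball_le (a r : R) : 0 <= r ->
  (unif [set t | (`|unit_id t - a| <= r)%R] <= (2 * r `^ 1)%:E)%E.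
Proof.
move=> r0; apply: (@le_trans _ _ (lambda `[a - r, a + r])).
  apply: unif_le => // [|t t01].
    exact: measurable_dist_le.
  by rewrite /= /unit_id /on_unit t01 in_itv /= ler_distl.
rewrite lebesgue_measure_itv /= lte_fin; case: ifP => _; last first.
  by rewrite lee_fin mulr_ge0 ?powR_ge0.
by rewrite -EFinB lee_fin powRr1//; lra.
Qed.

Lemma dimH_perturbed_unit_id {m : nat} (mu : probability (Rm R m) R) (i0 : 'I_m) (k : nat)
  (delta : R) : 0 < delta <= 1 -> dimH (perturbed unif unit_id i0 k delta mu) = 1%E.
Proof.
move=> delta01; apply/eqP; rewrite eq_le; apply/andP; split; last first.
  exact: (dimH_perturbed_ge i0 k mu delta01 unif_unit_id_ball_le).
apply/lee_addgt0Pr => e e0; rewrite -EFinD; have e1 : 1 < 1 + e by rewrite ltrDl.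
apply: dimH_perturbed_le => //; first by rewrite addr_ge0// ltW.
exact: fine_ball_covers_bounded e1 unit_id_le1.
Qed.

End UniformProfiles.

(** * The digit-erasing map *)

Section Windows.
Implicit Types (i j J u : nat).

(* The binary digits of rank in [(win j, 4 * win j]] form the [j]-th window; the windows before it
   have total length [lost j]. *)
Definition win j : nat := \prod_(i < j) (i + 8).

Definition lost j : nat := \sum_(i < j) 3 * win i.

Lemma winS j : win j.+1 = ((j + 8) * win j)%N.
Proof. by rewrite /win big_ord_recr mulnC. Qed.

Lemma lostS j : lost j.+1 = (lost j + 3 * win j)%N.
Proof. by rewrite /lost big_ord_recr. Qed.

Lemma ltn_win j : (j < win j)%N.
Proof. by elim: j => [|j IH]; [rewrite /win big_ord0 | rewrite winS; nia]. Qed.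

Lemma lost_le_win j : (2 * lost j <= win j)%N.
Proof. by elim: j => [|j IH]; [rewrite /lost big_ord0 | rewrite lostS winS; nia]. Qed.

Lemma lost_mul_le j : ((j + 7) * lost j <= 4 * win j)%N.
Proof.
case: j => [|j]; first by rewrite /lost big_ord0 muln0.
by rewrite lostS winS; have := lost_le_win j; nia.
Qed.

Lemma mul4_win_lt i j : (i < j)%N -> (4 * win i < win j)%N.
Proof.
elim: j => // j IH; rewrite ltnS leq_eqVlt winS.
by move=> /predU1P[->|/IH]; have := ltn_win j; nia.
Qed.

Lemma leq_win i j : (i <= j)%N -> (win i <= win j)%N.
Proof. by rewrite leq_eqVlt => /predU1P[->//|/mul4_win_lt]; lia. Qed.

Lemma window_before u : exists J, (u <= win J.+1)%N /\ ((J + 7) * lost J <= 4 * u)%N.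
Proof.
have ex : exists J, (u <= win J.+1)%N by exists u; have := ltn_win u.+1; lia.
exists (ex_minn ex); case: ex_minnP => -[|J] uJ minJ; split=> //.
  by rewrite /lost big_ord0 muln0.
have : (win J.+1 < u)%N by rewrite ltnNge; apply/negP => /minJ; rewrite ltnn.
by have := lost_mul_le J.+1; lia.
Qed.

End Windows.

Section DigitErasing.
Context {R : realType}.
Implicit Types (t : R) (j J K n p : nat).

Definition window j t : R := dyfloor (4 * win j) t - dyfloor (win j) t.

Lemma window_ge0 j t : 0 <= window j t.
Proof. by rewrite subr_ge0 le_dyfloor// leq_pmull. Qed.

Lemma window_lt j t : window j t < dy (win j).
Proof.
rewrite /window; have := dyfloor_le (4 * win j) t; have := lt_dyfloorD (win j) t; lra.
Qed.

Lemma window_digits j t :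
  exists2 v : nat, (v < 2 ^ (3 * win j))%N & window j t = v%:R * dy (4 * win j).
Proof.
have dyw : dy (win j) = (2 ^ (3 * win j))%N%:R * dy (4 * win j) :> R.
  by rewrite natrX exp2_dyB ?leq_mul2r ?orbT// -mulnBl mul1n.
have windowE : window j t = (Num.floor (2 ^+ (4 * win j) * t)
    - (2 ^ (3 * win j))%N%:Z * Num.floor (2 ^+ win j * t))%:~R * dy (4 * win j).
  by rewrite /window /dyfloor intrB intrM mulrBl dyw -pmulrn mulrCA mulrA.
set z := (X in X%:~R * _) in windowE.
have z0 : 0 <= z.
  by have := window_ge0 j t; rewrite windowE pmulr_lge0 ?dy_gt0// ler0z.
exists (absz z); last by rewrite windowE -{1}(gez0_abs z0).
have := window_lt j t; rewrite windowE -{1}(gez0_abs z0) dyw.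
by rewrite ltr_pM2r ?dy_gt0// ltr_nat.
Qed.

(* The [j]-th dyadic interval, generation after generation: [j + 1 - 2 ^ p] is its rank in the
   generation [p = trunc_log 2 (j + 1)]. *)
Definition erases j t : bool :=
  Num.floor (2 ^+ trunc_log 2 j.+1 * t) + (2 ^ trunc_log 2 j.+1)%N == j.+1.

Lemma erases_ex p t : 0 <= t < 1 -> exists2 j, (2 ^ p <= j.+1 < 2 ^ p.+1)%N & erases j t.
Proof.
move=> /andP[t0 t1].
have fl0 : 0 <= Num.floor (2 ^+ p * t) by rewrite floor_ge0 mulr_ge0// exprn_ge0.
have flp : Num.floor (2 ^+ p * t) < (2 ^ p)%N :> int.
  by rewrite floor_lt_int /= -pmulrn natrX -[ltRHS]mulr1 ltr_pM2l ?exprn_gt0.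
move: fl0 flp; case flE : (Num.floor _) => [k|//] _; rewrite ltz_nat => kp.
have p0 : (0 < 2 ^ p)%N by rewrite expn_gt0.
have kS : (k + 2 ^ p).-1.+1 = (k + 2 ^ p)%N by lia.
have gen : (2 ^ p <= (k + 2 ^ p).-1.+1 < 2 ^ p.+1)%N by rewrite kS expnS; lia.
by exists (k + 2 ^ p).-1 => //; rewrite /erases (trunc_log_eq _ gen)// flE kS.
Qed.

Lemma erases_itv j : exists c : R, [set t | erases j t] = `[c, c + dy (trunc_log 2 j.+1)[%classic.
Proof.
set p := trunc_log 2 j.+1; set z : int := j.+1%:Z - (2 ^ p)%N%:Z.
exists (z%:~R * dy p).
have erasesE t : erases j t = (z%:~R * dy p <= t < z%:~R * dy p + dy p).
  rewrite /erases -/p eq_sym -subr_eq eq_sym -/z floor_eq intrD.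
  rewrite -[X in _ = (_ <= _ < _ + X)]mul1r -mulrDl dyV ler_pdivrMr ?ltr_pdivlMr ?exprn_gt0//.
  by rewrite [t * _]mulrC.
by apply/seteqP; split => t /=; rewrite in_itv /= erasesE.
Qed.

Definition erase_upto J t : R := t - \sum_(i < J) (erases i t)%:R * window i t.

Lemma erase_upto0 t : erase_upto 0 t = t. Proof. by rewrite /erase_upto big_ord0 subr0. Qed.

Lemma erase_uptoS J t : erase_upto J.+1 t = erase_upto J t - (erases J t)%:R * window J t.
Proof. by rewrite /erase_upto big_ord_recr /= opprD addrA. Qed.

Lemma erase_uptoB J K t : (J <= K)%N ->
  0 <= erase_upto J t - erase_upto K t <= 2 * (dy (win J) - dy (win K)).
Proof.
move=> /subnK <-; elim: (K - J)%N => [|n IH]; first by rewrite add0n; lra.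
rewrite addSn; have : 2 * dy (win (n + J).+1) <= dy (win (n + J)) :> R.
  by rewrite (dyS (win (n + J))) ler_pM2l// le_dy//; have := mul4_win_lt (ltnSn (n + J)); lia.
rewrite erase_uptoS; have := window_ge0 (n + J) t; have := window_lt (n + J) t.
have := dy_gt0 (R := R) (win (n + J)); case: erases => /=; lra.
Qed.

Definition erase t : R := limn (erase_upto ^~ t).

Lemma erase_upto_cvg t : erase_upto ^~ t @ \oo --> erase t.
Proof.
apply: nonincreasing_is_cvgn => [J K JK|].
  by have := erase_uptoB t JK; lra.
exists (erase_upto 0 t - 2 * dy (win 0)) => _ [K _ <-] /=.
by have := erase_uptoB t (leq0n K); have := dy_gt0 (R := R) (win K); lra.
Qed.

Lemma erase_uptoB_erase J t : 0 <= erase_upto J t - erase t <= 2 * dy (win J).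
Proof.
have cv : cvgn (erase_upto ^~ t) := @erase_upto_cvg t.
rewrite subr_ge0 lerBlDl -lerBlDr; apply/andP; split.
  by apply: limr_le => //; exists J => // K /= JK; have := erase_uptoB t JK; lra.
apply: limr_ge => //; exists J => // K /= JK; have := erase_uptoB t JK.
by have := dy_gt0 (R := R) (win K); lra.
Qed.

Lemma measurable_erase : measurable_fun setT erase.
Proof.
apply: (@measurable_fun_cvg _ _ _ _ erase_upto) => [J|t _]; last exact: erase_upto_cvg.
elim: J => [|J IH].
  by rewrite (_ : erase_upto 0 = id) //; apply/funext => t; rewrite erase_upto0.
rewrite (_ : erase_upto J.+1 = fun t => erase_upto J t - \1_[set t | erases J t] t * window J t).
  apply: measurable_funB => //; apply: measurable_funM.
    by apply: measurable_indic; have [c ->] := erases_itv J.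
  by apply: measurable_funB; exact: measurable_dyfloor.
by apply/funext => t; rewrite erase_uptoS indicE mem_setE.
Qed.

Fixpoint erased_values J : seq R := if J is K.+1 then
    [seq o + v%:R * dy (4 * win K) | o <- erased_values K, v <- iota 0 (2 ^ (3 * win K))]
  else [:: 0].

Lemma size_erased_values J : size (erased_values J) = (2 ^ lost J)%N.
Proof.
elim: J => [|J IH]; first by rewrite /lost big_ord0.
by rewrite lostS expnD [LHS]size_allpairs IH size_iota.
Qed.

Lemma mem_erased_values J t : t - erase_upto J t \in erased_values J.
Proof.
elim: J => [|J IH]; first by rewrite erase_upto0 subrr inE.
rewrite erase_uptoS opprB addrCA addrC; have [v vlt vE] := window_digits J t.
case: (erases J t); rewrite /= ?mul1r ?mul0r.
  by apply/allpairsP; exists (t - erase_upto J t, v); split => //=; rewrite ?mem_iota ?vE.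
apply/allpairsP; exists (t - erase_upto J t, 0%N); split => //=; last by rewrite mul0r.
by rewrite mem_iota expn_gt0.
Qed.

Lemma erase_uptoB_grid j t : exists z : int, t - erase_upto j t = z%:~R * dy (win j).
Proof.
rewrite /erase_upto opprB addrC subrK.
apply: (big_ind (fun x : R => exists z : int, x = z%:~R * dy (win j))).
- by exists 0; rewrite mul0r.
- by move=> _ _ [z ->] [z' ->]; exists (z + z'); rewrite intrD mulrDl.
move=> i _; have [v _ ->] := window_digits i t.
have ij := ltnW (mul4_win_lt (ltn_ord i)).
exists ((erases i t)%:R * (v * 2 ^ (win j - 4 * win i))%N%:Z).
rewrite intrM -mulrA; congr (_ * _); first by case: erases.
by rewrite -pmulrn natrM natrX -mulrA exp2_dyB ?leq_subr// subKn.
Qed.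

Lemma erase_near_grid j t : erases j t ->
  exists y : int, `|erase t - y%:~R * dy (win j)| <= dy (4 * win j) /\
    dyfloor (win j) t - (t - erase_upto j t) = y%:~R * dy (win j).
Proof.
move=> ej; have [z zE] := erase_uptoB_grid j t.
exists (Num.floor (2 ^+ win j * t) - z); rewrite intrB mulrBl -zE -/(dyfloor _ _); split=> //.
have next : 2 * dy (win j.+1) <= dy (4 * win j) :> R.
  by rewrite [leRHS]dyS ler_pM2l// le_dy//; have := mul4_win_lt (ltnSn j); lia.
have := erase_uptoS j t; rewrite ej mul1r /window.
have := erase_uptoB_erase j.+1 t; have := dyfloor_le (4 * win j) t.
have := lt_dyfloorD (4 * win j) t; rewrite ler_norml; lra.
Qed.

Lemma erase_near_nat_grid j t : 0 <= t < 1 -> erases j t ->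
  exists2 g : nat, (g <= 2 ^ (win j).+1)%N &
    `|erase t - (g%:R * dy (win j) - 1)| <= dy (4 * win j).
Proof.
move=> /andP[t0 t1] /erase_near_grid[y [near_y yE]].
have w0 : dy (win 0) = 2^-1 :> R by rewrite /win big_ord0.
have fl0 : 0 <= dyfloor (win j) t.
  by rewrite mulr_ge0 ?dy_ge0// ler0z floor_ge0 mulr_ge0 ?exprn_ge0.
have := erase_uptoB t (leq0n j); rewrite erase_upto0 w0 => tj.
have flt := dyfloor_le (win j) t; have dj := dy_gt0 (R := R) (win j).
have nX : (2 ^ win j)%N%:~R * dy (win j) = 1 :> R by rewrite -pmulrn natrX exp2_dy.
have y1 : 0 <= y + (2 ^ win j)%N.
  by rewrite -(ler0z R) -(pmulr_lge0 _ dj) intrD mulrDl nX -yE; lra.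
have y2 : y <= (2 ^ win j)%N by rewrite -(ler_int R) -(ler_pM2r dj) nX -yE; lra.
exists (absz (y + (2 ^ win j)%N)); first by rewrite expnS; lia.
by rewrite pmulrn gez0_abs// intrD mulrDl nX addrK.
Qed.

Definition unit_erase := on_unit erase.

HB.instance Definition _ :=
  isMeasurableFun.Build _ _ _ _ unit_erase (measurable_on_unit measurable_erase).

Lemma unit_erase_le1 t : `|unit_erase t| <= 1.
Proof.
rewrite /unit_erase /on_unit; case: ifP => [t01|_]; last by rewrite normr0.
have := erase_uptoB_erase 0 t; rewrite erase_upto0 /win big_ord0 /dy expr1 ler_norml; lra.
Qed.

End DigitErasing.

(** * Concentration and covers of the digit-erasing map *)

Section ErasingLaw.
Context {R : realType}.
Implicit Types (s : seq R) (t : R) (u U J p : nat).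
Local Notation unif := (unif (R := R)).
Local Notation unit_erase := (unit_erase (R := R)).
Local Notation hit s u := (unit_erase @^-1` near_seq s (dy u)).

Let measurable_hit s u : measurable (hit s u).
Proof. exact: measurable_preimage_near_seq. Qed.

Lemma near_seq_erase s offsets J u t : (u <= win J)%N -> 0 <= t < 1 ->
  t - erase_upto J t \in offsets -> hit s u t ->
  near_seq [seq a + o | a <- s, o <- offsets] (2 ^+ 2 * dy u) t.
Proof.
move=> uJ t01 toff; rewrite /preimage /= /unit_erase /on_unit t01 => /hasP[a aA ta].
apply/hasP; exists (a + (t - erase_upto J t)); first exact: allpairs_f.
have := erase_uptoB_erase J t; have := le_dy (R := R) uJ; have := dy_gt0 (R := R) u.
by move: ta; rewrite expr2 !ltr_norml; lra.
Qed.

Lemma size_sum_offsets_le s U J : (size s <= 2 ^ U)%N ->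
  (size [seq (a + o)%R | a <- s, o <- erased_values (R := R) J] <= 2 ^ (U + lost J))%N.
Proof. by move=> sU; rewrite size_allpairs size_erased_values expnD leq_mul2r sU orbT. Qed.

Lemma unif_hit_le s U J u : (size s <= 2 ^ U)%N -> (u <= win J)%N ->
  (unif (hit s u) <= (dy (u - (U + lost J).+3))%:E)%E.
Proof.
move=> sU uJ; rewrite -addn2; apply: (unif_near_seq_le _ (size_sum_offsets_le J sU)) => [|t t01].
  exact: measurable_hit.
by apply: (near_seq_erase uJ t01); exact: mem_erased_values.
Qed.

Lemma unif_erases_le J : (unif [set t | erases J t] <= (dy (trunc_log 2 J.+1))%:E)%E.
Proof.
have [c Jc] := erases_itv (R := R) J.
have mJ : measurable [set t : R | erases J t] by rewrite Jc.
apply: le_trans (unif_le mJ mJ _) _ => //; rewrite {}Jc.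
by rewrite lebesgue_measure_itv /= lte_fin ltrDl dy_gt0 -EFinD addrAC subrr add0r.
Qed.

Lemma unif_hit_le_erases s U J u : (size s <= 2 ^ U)%N -> (u <= win J.+1)%N ->
  (unif (hit s u) <= (dy (trunc_log 2 J.+1) + dy (u - (U + lost J).+3))%:E)%E.
Proof.
move=> sU uJ; pose F : set R := [set t | erases J t].
have mF : measurable F by rewrite /F; have [c ->] := erases_itv (R := R) J.
have hitF : hit s u `<=` F `|` (hit s u `\` F).
  by move=> t ht; have [Ft|Ft] := pselect (F t); [left|right].
have mhitF : measurable (hit s u `\` F) by apply: measurableD => //; exact: measurable_hit.
apply: le_trans (le_measure unif _ _ hitF) _; rewrite ?inE.
- exact: measurable_hit.
- exact: measurableU.
apply: le_trans (measureU2 _ _ _) _ => //.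
rewrite EFinD; apply: leeD; first exact: unif_erases_le.
rewrite -addn2; apply: (unif_near_seq_le _ (size_sum_offsets_le J sU)) => //.
move=> t t01 [ht /negP nF]; apply: (near_seq_erase uJ t01 _ ht).
by rewrite erase_uptoS (negbTE nF) mul0r subr0 mem_erased_values.
Qed.

(* The windows ending before [u] erase at most 7/8 of the first [u] digits; if [u] lies in a window,
   the scale at which this window starts is used instead. *)
Lemma unif_hit_le_eighth s U u : (size s <= 2 ^ U)%N ->
  (unif (hit s u) <= (dy (u %/ 8 - U.+3))%:E)%E.
Proof.
move=> sU; have ex : exists j, (u <= win j)%N by exists u; exact/ltnW/ltn_win.
case: (ex_minnP ex) => -[|j] uj minj.
  apply: le_trans (unif_hit_le sU uj) _; rewrite lee_fin le_dy// /lost big_ord0; lia.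
have ju : (win j < u)%N by rewrite ltnNge; apply/negP => /minj; rewrite ltnn.
have := lost_le_win j; have := lostS j; have [u4|u4] := leqP (4 * win j) u.
  by move=> *; apply: le_trans (unif_hit_le sU uj) _; rewrite lee_fin le_dy//; lia.
move=> *; apply: (@le_trans _ _ (unif (hit s (win j)))).
  apply: le_measure; rewrite ?inE; [exact: measurable_hit|exact: measurable_hit|].
  by move=> t; apply: near_seq_homo; apply: le_dy; exact: ltnW.
by apply: le_trans (unif_hit_le sU (leqnn _)) _; rewrite lee_fin le_dy//; lia.
Qed.

Lemma unif_hit_series_le s U J : (size s <= 2 ^ U)%N -> (8 * U.+3 <= win J.+1)%N ->
  (\sum_(0 <= u <oo) unif (hit s u) <=
   ((8 * U.+3)%:R * dy (trunc_log 2 J.+1) + (U + lost J).+3%:R + 18)%:E)%E.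
Proof.
move=> sU UJ; have hit0 u : (0 <= unif (hit s u))%E := measure_ge0 _ _.
rewrite (nneseries_split 0 (8 * U.+3))// add0n -(nneseries_addn _ hit0).
rewrite (_ : _ + 18 = (8 * U.+3)%:R * dy (trunc_log 2 J.+1) + ((U + lost J).+3%:R + 2) + 16);
  last by ring.
rewrite EFinD; apply: leeD.
  rewrite big_mkord; apply: (@le_trans _ _
      (\sum_(u < 8 * U.+3) (dy (trunc_log 2 J.+1) + dy (u - (U + lost J).+3))%:E)%E).
    apply: lee_sum => u _; apply: unif_hit_le_erases => //.
    exact: leq_trans (ltnW (ltn_ord u)) UJ.
  rewrite sumEFin lee_fin big_split /= sumr_const card_ord -[X in X + _ <= _]mulr_natl lerD2l.
  exact: sum_dyB.
apply: lime_le; first by apply: is_cvg_nneseries => u _ _; exact: hit0.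
near=> n; rewrite big_mkord.
apply: (@le_trans _ _ (\sum_(u < n) (dy (u %/ 8))%:E)%E).
  apply: lee_sum => u _; apply: le_trans (unif_hit_le_eighth _ sU) _.
  by rewrite mulnC divnDMl// addnK.
by rewrite sumEFin lee_fin; exact: sum_dy_divn.
Unshelve. all: by end_near. Qed.

Lemma dy_trunc_log_le J : dy (trunc_log 2 J.+1) <= 2 / J.+1%:R :> R.
Proof.
rewrite ler_pdivlMr// dyV mulrC ler_pdivrMr ?exprn_gt0// -exprS -natrX ler_nat.
by apply: ltnW; exact: trunc_log_ltn.
Qed.

Lemma spread_unit_erase : spread unif unit_erase.
Proof.
apply: spread_of_exp2 => e e0; exists (3 * (1 + e) + 18).
have [J0 J0e] := filter_ex (nbhs_infty_ger (48 / e)).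
exists (win J0) => // U /= J0U s sU.
have [J [UJ lostJ]] := window_before (8 * U.+3).
have J0J : (J0 <= J)%N.
  by rewrite leqNgt; apply/negP => /leq_win; lia.
apply: le_trans (unif_hit_series_le sU UJ) _; rewrite lee_fin.
have J1 : 0 < J.+1%:R :> R by [].
have dyJ : (8 * U.+3)%:R * dy (trunc_log 2 J.+1) <= U.+3%:R * (16 / J.+1%:R) :> R.
  apply: le_trans (ler_wpM2l (ler0n R _) (dy_trunc_log_le J)) _.
  by rewrite natrM le_eqVlt; apply/orP; left; apply/eqP; move: U.+3 => X; ring.
have lostJ' : (lost J)%:R <= U.+3%:R * (32 / J.+1%:R) :> R.
  rewrite mulrA ler_pdivlMr// -!natrM ler_nat; move: lostJ; nia.
have Je : 48 / J.+1%:R <= e.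
  rewrite ler_pdivrMr// mulrC -ler_pdivrMr//; apply: le_trans J0e _.
  by rewrite ler_nat leqW.
have U3 : U.+3%:R = U%:R + 3 :> R by rewrite -addn3 natrD.
have {}Je : U.+3%:R * (16 / J.+1%:R) + U.+3%:R * (32 / J.+1%:R) <= U.+3%:R * e.
  by apply: le_trans (ler_wpM2l (ler0n R U.+3) Je); rewrite -mulrDr -mulrDl -natrD.
have -> : (U + lost J).+3%:R = U%:R + 3 + (lost J)%:R :> R by rewrite -!addSn natrD U3.
rewrite U3 in dyJ lostJ' Je; move: dyJ lostJ' Je.
by move: (_ * dy _) ((_ + 3) * (16 / _)) ((_ + 3) * (32 / _)) => ? ? ?; lra.
Qed.

Definition erase_cover p : seq (R * R) :=
  [seq (g%:R * dy (win j) - 1, dy (4 * win j))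
  | j <- iota (2 ^ p).-1 (2 ^ p), g <- iota 0 (2 ^ (win j).+1).+1].

Lemma erase_coverP p t : exists2 c, c \in erase_cover p & `|unit_erase t - c.1| <= c.2.
Proof.
suff [j [g [jp gj near_g]]] : exists j g, [/\ (2 ^ p <= j.+1 < 2 ^ p.+1)%N,
    (g <= 2 ^ (win j).+1)%N & `|unit_erase t - (g%:R * dy (win j) - 1)| <= dy (4 * win j)].
  exists (g%:R * dy (win j) - 1, dy (4 * win j)) => //.
  apply/allpairsPdep; exists j, g; rewrite !mem_iota; split=> //.
  by move: jp; rewrite expnS; lia.
rewrite /unit_erase /on_unit; case: ifP => [t01|_].
  have [j jp ej] := erases_ex p t01; have [g gj near_g] := erase_near_nat_grid t01 ej.
  by exists j, g.
exists (2 ^ p).-1, (2 ^ win (2 ^ p).-1)%N; split.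
- have p0 : (0 < 2 ^ p)%N by rewrite expn_gt0.
  by rewrite expnS; lia.
- by rewrite leq_exp2l.
- by rewrite natrX exp2_dy subrr subr0 normr0 dy_ge0.
Qed.

Lemma erase_cover_generation p j : j \in iota (2 ^ p).-1 (2 ^ p) -> (p + p <= win j)%N.
Proof.
rewrite mem_iota => /andP[jp _]; have := ltn_win j.
have : (p + p <= 2 ^ p)%N by elim: p {jp} => [|[|p] IH] //; rewrite expnS; lia.
by move: jp; lia.
Qed.

Lemma powR12_dy_le n : (2 * dy (4 * n)) `^ 2^-1 <= 2 * dy (2 * n) :> R.
Proof.
rewrite powR12_sqrt ?mulr_ge0 ?dy_ge0// -(@ler_pXn2r _ 2)// ?nnegrE ?sqrtr_ge0 ?mulr_ge0 ?dy_ge0//.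
rewrite sqr_sqrtr ?mulr_ge0 ?dy_ge0// exprMn (_ : dy (2 * n) ^+ 2 = dy (4 * n)).
  by rewrite ler_pM2r ?dy_gt0// -natrX ler_nat.
by rewrite /dy -exprM; congr (_ ^+ _); lia.
Qed.

Lemma erase_cover_sum_le p : \sum_(c <- erase_cover p) (2 * c.2) `^ 2^-1 <= 8 * dy p.
Proof.
have window_sum_le j : \sum_(g <- iota 0 (2 ^ (win j).+1).+1) (2 * dy (4 * win j)) `^ 2^-1
    <= 8 * dy (win j) :> R.
  rewrite big_const_seq count_predT size_iota iter_addr_0 -[leLHS]mulr_natl.
  apply: le_trans (ler_wpM2l (ler0n _ _) (powR12_dy_le _)) _.
  apply: (@le_trans _ _ ((4 * 2 ^ win j)%N%:R * (2 * dy (2 * win j)))).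
    apply: ler_wpM2r; first by rewrite mulr_ge0 ?dy_ge0.
    have : (0 < 2 ^ win j)%N by rewrite expn_gt0.
    by rewrite ler_nat expnS; lia.
  rewrite mul2n -addnn dyD natrM natrX.
  rewrite (_ : _ * _ = 8 * ((2 ^+ win j * dy (win j)) * dy (win j))); last by ring.
  by rewrite exp2_dy mul1r.
rewrite big_allpairs_dep /=.
apply: (@le_trans _ _ (\sum_(j <- iota (2 ^ p).-1 (2 ^ p)) 8 * (dy p * dy p))).
  rewrite big_seq [leRHS]big_seq; apply: ler_sum => j /erase_cover_generation pj.
  by apply: le_trans (window_sum_le j) _; rewrite ler_pM2l// -dyD le_dy.
rewrite big_const_seq count_predT size_iota iter_addr_0 -[leLHS]mulr_natl natrX.
by rewrite mulrCA [2 ^+ p * _]mulrA exp2_dy mul1r.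
Qed.

Lemma fine_ball_covers_unit_erase :
  fine_ball_covers (fun x y => `|x - y|) 2^-1 (range unit_erase).
Proof.
move=> e e0; have [p pe] := filter_ex (near_mul_dy_le 8 e0).
exists (erase_cover p); split.
- move=> _ /allpairsPdep[j [g [/erase_cover_generation pj _ ->]]] /=; rewrite dy_ge0 /=.
  have : dy (4 * win j) <= dy p :> R by apply: le_dy; lia.
  by have := dy_ge0 (R := R) p; lra.
- by move=> _ [t _ <-]; exact: erase_coverP.
- exact: le_trans (erase_cover_sum_le p) pe.
Qed.

End ErasingLaw.

(** * Density *)

Section Density.
Context {R : realType} {m : nat} (i0 : 'I_m).
Implicit Types (mu nu : probability (Rm R m) R).

Lemma Dr_lim_cst nu (D : R) : (forall r, 0 < r -> has_Dr nu r D) -> Dr_lim nu D.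
Proof.
move=> DrD; exists 1; split=> //; exists (fun=> D); split; last exact: cvg_cst.
by move=> r /andP[r0 _]; exact: DrD.
Qed.

Lemma perturbed_close {d} {T : measurableType d} (P : probability T R) (f : {mfun T >-> R})
    mu (eps : R) : (forall t, `|f t| <= 1) -> in_Omega mu -> 0 < eps ->
  exists k delta, 0 < delta <= 1 /\ (dL mu (perturbed P f i0 k delta mu) < eps%:E)%E.
Proof.
move=> f1 imu eps0; have eps2 : 0 < eps / 2 by rewrite divr_gt0.
have [k muk] := round_approx imu eps2; pose delta := Num.min 1 (eps / 2).
have delta0 : 0 < delta by rewrite lt_min ltr01.
exists k, delta; rewrite delta0 ge_min lexx; split=> //.
apply: lt_le_trans (dL_perturbed P i0 f1 (ltW delta0) imu muk) _.
by rewrite [in leRHS](splitr eps) lee_fin lerD2l ge_min lexx orbT.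
Qed.

Lemma perturbed_unit_id_Omega0 mu k (delta : R) : 0 < delta <= 1 ->
  Omega0 (perturbed unif unit_id i0 k delta mu).
Proof.
move=> delta01.
have [Dr1 D01] :=
  perturbed_dimension1 (f := unit_id) i0 k mu delta01 (@unit_id_le1 R) spread_unit_id.
split; first by apply: perturbed_in_Omega; [exact: unit_id_le1|case/andP: delta01 => /ltW].
by exists 1; split; [exact: Dr_lim_cst|split=> //; exact: dimH_perturbed_unit_id].
Qed.

Lemma perturbed_unit_erase_Omega0gt mu k (delta : R) : 0 < delta <= 1 ->
  Omega0gt (perturbed unif unit_erase i0 k delta mu).
Proof.
move=> delta01.
have [Dr1 D01] :=
  perturbed_dimension1 (f := unit_erase) i0 k mu delta01 (@unit_erase_le1 R) spread_unit_erase.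
split; first by apply: perturbed_in_Omega; [exact: unit_erase_le1|case/andP: delta01 => /ltW].
exists 1; split; [exact: Dr_lim_cst|split=> //].
apply: (@le_lt_trans _ _ (2^-1)%:E); last by rewrite lte_fin invf_lt1// ltr1n.
by apply: dimH_perturbed_le => //; exact: fine_ball_covers_unit_erase.
Qed.

End Density.

Theorem theorem3p11 (R : realType) (m : nat) (hm : (0 < m)%N) :
  (forall (mu : probability (Rm R m) R), in_Omega mu ->
     forall eps : R, 0 < eps ->
     exists nu : probability (Rm R m) R, Omega0 nu /\ (dL mu nu < eps%:E)%E) /\
  (forall (mu : probability (Rm R m) R), in_Omega mu ->
     forall eps : R, 0 < eps ->
     exists nu : probability (Rm R m) R, Omega0gt nu /\ (dL mu nu < eps%:E)%E).
Proof.
pose i0 := Ordinal hm; split=> mu imu eps eps0.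
- have [k [delta [delta01 close]]] :=
    perturbed_close i0 unif (f := unit_id) (@unit_id_le1 R) imu eps0.
  exists (perturbed unif unit_id i0 k delta mu).
  by split=> //; exact: perturbed_unit_id_Omega0.
- have [k [delta [delta01 close]]] :=
    perturbed_close i0 unif (f := unit_erase) (@unit_erase_le1 R) imu eps0.
  exists (perturbed unif unit_erase i0 k delta mu).
  by split=> //; exact: perturbed_unit_erase_Omega0gt.
Qed.
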